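(* Let $n\ge 1$ and let $a=(a_1,\dots,a_n)$ and $b=(b_1,\dots,b_n)$ be two nondecreasing sequences of positive real numbers satisfying $a_n<b_1$. Let $\Phi:T^n\to \operatorname{SympEmb}(E(a),E(b))$ be the family of symplectic embeddings $\Phi(\theta)=U_\theta|_{E(a)}$. Then the induced map \[\Phi_*:H_k(T^n;\mathbb{Z}/2)\to H_k(\operatorname{SympEmb}(E(a),E(b));\mathbb{Z}/2)\] has rank $1$ for $k=0$ and for $k=1$, and rank $0$ for all $k\ge 2$.
   Context: For a nondecreasing sequence of positive reals $a=(a_1,\dots,a_n)$, the symplectic ellipsoid is $E(a)=\{(z_1,\dots,z_n)\in\mathbb{C}^n \mid \sum_{i=1}^n \pi|z_i|^2/a_i\le 1\}$, with the restriction of the standard symplectic form $d\lambda$, where $\lambda=\frac12\sum_i (x_i\,dy_i-y_i\,dx_i)$. $T^n=(\mathbb{R}/2\pi\mathbb{Z})^n$, and for $\theta=(\theta_1,\dots,\theta_n)\in T^n$, $U_\theta:\mathbb{C}^n\to\mathbb{C}^n$ is the unitary map $U_\theta(z_1,\dots,z_n)=(e^{i\theta_1}z_1,\dots,e^{i\theta_n}z_n)$. When $a_i<b_i$ for all $i$, $U_\theta$ maps $E(a)$ into the interior of $E(b)$. $\operatorname{SympEmb}(U,V)$ denotes the space of symplectic embeddings $\varphi:U\to\operatorname{int}(V)$ (smooth embeddings with $\varphi^*\omega_V=\omega_U$), with the $C^\infty$ (compact-open) topology. *)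

(* Defs.v *)
From HB Require Import structures.
From mathcomp Require Import all_boot all_order all_algebra.
From mathcomp Require Import generic_quotient ring_quotient.
From mathcomp Require Import all_classical all_reals all_analysis.
From mathcomp Require Import ring lra.
From mathcomp.multinomials Require Import freeg.

Set Implicit Arguments.
Unset Strict Implicit.
Unset Printing Implicit Defensive.

Import Order.TTheory GRing.Theory Num.Theory.
Import numFieldNormedType.Exports.

Local Open Scope classical_set_scope.
Local Open Scope ring_scope.

(* The image of f has a basis with r elements; no finiteness of U or V is
   assumed. *)
Definition has_rank (F : fieldType) (U V : lmodType F) (f : {linear U -> V})
    (r : nat) : Prop :=
  exists e : 'I_r -> V,
    [/\ forall i, range f (e i),
        forall c : 'I_r -> F, \sum_i c i *: e i = 0 -> forall i, c i = 0
      & forall u, exists c : 'I_r -> F, f u = \sum_i c i *: e i].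

(* ker d0 / (im d1 :&: ker d0). In a chain complex d0 \o d1 = 0, so this is
   ker d0 / im d1. *)
Section Homology.
Variables (F : fieldType) (C A B : lmodType F).
Variables (d1 : {linear C -> A}) (d0 : {linear A -> B}).

Definition is_cycle : {pred A} := [pred x | d0 x == 0].

Lemma is_cycle_submod_closed : submod_closed is_cycle.
Proof.
split=> [|a x y]; rewrite !inE ?linear0// => /eqP x0 /eqP y0.
by rewrite linearP x0 y0 scaler0 addr0.
Qed.

HB.instance Definition _ :=
  GRing.isSubmodClosed.Build F A is_cycle is_cycle_submod_closed.

Record cycles := Cycle { cycle_val : A; cycleP : cycle_val \in is_cycle }.

HB.instance Definition _ := [isSub for cycle_val].
HB.instance Definition _ := [Choice of cycles by <:].
HB.instance Definition _ := [SubChoice_isSubLmodule of cycles by <:].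

Definition is_boundary : {pred cycles} :=
  [pred z | `[< exists c, d1 c = val z >]].

Lemma is_boundary_submod_closed : submod_closed is_boundary.
Proof.
split=> [|a x y]; first by apply/asboolP; exists 0; rewrite linear0.
move=> /asboolP[c cx] /asboolP[d dy]; apply/asboolP.
by exists (a *: c + d); rewrite linearP cx dy.
Qed.

HB.instance Definition _ :=
  GRing.isSubmodClosed.Build F cycles is_boundary is_boundary_submod_closed.

Definition homology := Quotient.quot is_boundary.

HB.instance Definition _ := GRing.Zmodule.on homology.

Definition homology_class (z : cycles) : homology := \pi_(homology)%qT z.

Lemma homology_classP (z z' : cycles) :
  reflect (exists c, d1 c = val (z - z'))
          (homology_class z == homology_class z').
Proof.
by rewrite -[_ == _]/(_ == _ %[mod _])%qT -Quotient.idealrBE; exact: asboolP.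
Qed.

Lemma homology_class_repr (h : homology) : homology_class (repr h) = h.
Proof. exact: reprK. Qed.

Lemma homology_classB : {morph homology_class : x y / x - y}.
Proof. by move=> x y; rewrite /homology_class raddfB. Qed.

Lemma homology_classD : {morph homology_class : x y / x + y}.
Proof. by move=> x y; rewrite /homology_class raddfD. Qed.

Definition homology_scale (a : F) (h : homology) : homology :=
  homology_class (a *: repr h).

Lemma homology_class_scale a z :
  homology_scale a (homology_class z) = homology_class (a *: z).
Proof.
apply/eqP/homology_classP.
have /eqP/homology_classP[c dc] := homology_class_repr (homology_class z).
by exists (a *: c); rewrite linearZ dc -scalerBr linearZ.
Qed.

Fact homology_scaleA a b h :
  homology_scale a (homology_scale b h) = homology_scale (a * b) h.
Proof.
rewrite /homology_scale -/(homology_scale a _).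
by rewrite homology_class_scale scalerA.
Qed.

Fact homology_scale1 : left_id 1 homology_scale.
Proof. by move=> h; rewrite /homology_scale scale1r homology_class_repr. Qed.

Fact homology_scaleDr : right_distributive homology_scale +%R.
Proof.
move=> a h h'; rewrite -[h]homology_class_repr -[h']homology_class_repr.
by rewrite -homology_classD !homology_class_scale scalerDr homology_classD.
Qed.

Fact homology_scaleDl h : {morph homology_scale^~ h : a b / a + b}.
Proof. by move=> a b; rewrite /homology_scale scalerDl homology_classD. Qed.

HB.instance Definition _ := GRing.Zmodule_isLmodule.Build F homology
  homology_scaleA homology_scale1 homology_scaleDr homology_scaleDl.

End Homology.

Section HomologyMap.
Variables (F : fieldType) (C A B C' A' B' : lmodType F).
Variables (d1 : {linear C -> A}) (d0 : {linear A -> B}).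
Variables (d1' : {linear C' -> A'}) (d0' : {linear A' -> B'}).
Variables (fC : C -> C') (fA : {linear A -> A'}) (fB : {linear B -> B'}).
Hypothesis comm1 : forall c, fA (d1 c) = d1' (fC c).
Hypothesis comm0 : forall a, fB (d0 a) = d0' (fA a).

Lemma cycle_mapP (z : cycles d0) : fA (val z) \in is_cycle d0'.
Proof. by rewrite inE -comm0 (eqP (cycleP z)) linear0. Qed.

Definition cycle_map (z : cycles d0) : cycles d0' := Cycle (cycle_mapP z).

Definition homology_map_fun (h : homology d1 d0) : homology d1' d0' :=
  homology_class d1' (cycle_map (repr h)).

Lemma homology_map_class z :
  homology_map_fun (homology_class d1 z) = homology_class d1' (cycle_map z).
Proof.
apply/eqP/homology_classP.
have /eqP/homology_classP[c dc] :=
  homology_class_repr (homology_class d1 z).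
by exists (fC c); rewrite -comm1 dc !raddfB.
Qed.

Lemma homology_map_linear : linear homology_map_fun.
Proof.
move=> a h h'.
rewrite -[h]homology_class_repr -[h']homology_class_repr.
rewrite [a *: _]homology_class_scale -homology_classD !homology_map_class.
rewrite [a *: _]homology_class_scale -homology_classD.
by congr homology_class; apply: val_inj; rewrite /= linearP.
Qed.

Definition homology_map : {linear homology d1 d0 -> homology d1' d0'} :=
  HB.pack homology_map_fun (GRing.isLinear.Build F _ _ _
    homology_map_fun homology_map_linear).

End HomologyMap.

Section FreegLinear.
Variables (F : fieldType) (K : choiceType) (M : lmodType F) (f : K -> M).

Lemma fglift_linear : linear (fglift f : {freeg K / F} -> M).
Proof.
have liftD : {morph fglift f : x y / x + y}.
  move=> x y; have B := @lift_is_additive _ _ _ f.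
  have N z : fglift f (- z) = - fglift f z.
    by rewrite -[- z]sub0r B -{1}(subrr 0) B subrr sub0r.
  by rewrite -{1}[y]opprK B N opprK.
have lift0 : fglift f 0 = 0 by rewrite -(subrr 0) lift_is_additive subrr.
move=> a x y; rewrite liftD; congr (_ + _).
elim/freeg_ind_dom0: x => [|k z D _ _ IH]; first by rewrite !(scaler0, lift0).
rewrite scalerDr !liftD scalerDr IH; congr (_ + _).
have -> : a *: << k *g z >> = << a * k *g z >>.
  by apply/eqP/freeg_eqP => t; rewrite coeffZ !coeffU mulrA.
by rewrite !liftU scalerA.
Qed.

HB.instance Definition _ := GRing.isLinear.Build F {freeg K / F} M _
  (fglift f) fglift_linear.

End FreegLinear.

Lemma mx_continuous (T U : topologicalType) m n (f : T -> 'M[U]_(m, n)) :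
  (forall i j, continuous (fun t => f t i j)) -> continuous f.
Proof.
move=> fc t B [P Pnbhs PB]; apply: filterS PB _.
suff : \forall s \near t, forall ij : 'I_m * 'I_n, P ij.1 ij.2 (f s ij.1 ij.2).
  by apply: filterS => s Ps i j; exact: (Ps (i, j)).
by apply: filter_forall => -[i j] /=; apply: fc; exact: Pnbhs.
Qed.

Section SingularHomology.
Variables (R : realType) (F : fieldType).

Definition simplex (k : nat) : set 'rV[R]_k.+1 :=
  [set t | (forall i, 0 <= t ord0 i) /\ \sum_i t ord0 i = 1].

Arguments simplex : clear implicits.

(* Insertion of a zero i-th barycentric coordinate. *)
Definition face_vec (k : nat) (i : 'I_k.+2) (t : 'rV[R]_k.+1) : 'rV[R]_k.+2 :=
  \row_j if unlift i j is Some j' then t ord0 j' else 0.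

Lemma face_subproof k (i : 'I_k.+2) (t : simplex k) :
  face_vec i (val t) \in simplex k.+1.
Proof.
rewrite inE; have [t0 t1] := set_valP t; split=> [j|].
  by rewrite mxE; case: unliftP => [j' _|_] //; exact: t0.
rewrite (bigD1_ord i)//= mxE unlift_none add0r -[RHS]t1.
by apply: eq_bigr => j _; rewrite mxE liftK.
Qed.

Definition face_fun k (i : 'I_k.+2) (t : simplex k) : simplex k.+1 :=
  exist _ (face_vec i (val t)) (face_subproof i t).

Lemma face_continuous k (i : 'I_k.+2) : continuous (face_fun i).
Proof.
apply: continuous_comp_initial; apply: mx_continuous => r j.
rewrite (_ : (fun _ => _) = (fun t : simplex k =>
    if unlift i j is Some j' then set_val t ord0 j' else 0)); last first.
  by apply/funext => u; rewrite /= set_valE mxE.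
case: unliftP => [j' _|_]; last by move=> ?; exact: cst_continuous.
move=> t; apply: (continuous_comp (g := fun M : 'rV[R]_k.+1 => M ord0 j')).
  exact: initial_continuous.
exact: coord_continuous.
Qed.

Definition face k (i : 'I_k.+2) : continuousType (simplex k) (simplex k.+1) :=
  mkcts (@face_continuous k i).

Definition singular_simplex (X : topologicalType) k :=
  continuousType (simplex k) X.

Definition chain X k := {freeg (singular_simplex X k) / F}.

HB.instance Definition _ X k := GRing.Lmodule.on (chain X k).

Definition simplex_boundary X k (s : singular_simplex X k.+1) : chain X k :=
  \sum_(i < k.+2) (-1) ^+ i *: << (s \o face i : continuousType _ _) >>.

(* The complex stops in degree 0: boundary X 0 = 0 (and 0.-1 = 0 gives it a
   codomain). *)
Definition boundary X k : {linear chain X k -> chain X k.-1} :=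
  match k return {linear chain X k -> chain X k.-1} with
  | 0 => \0
  | k'.+1 => fglift (@simplex_boundary X k')
  end.

Definition singular_homology X k : lmodType F :=
  homology (boundary X k.+1) (boundary X k).

Variables (X Y : topologicalType) (f : continuousType X Y).

Definition chain_map k : {linear chain X k -> chain Y k} :=
  fglift (fun s : singular_simplex X k =>
            << (f \o s : continuousType _ _) >> : chain Y k).

Lemma chain_map_boundary k (c : chain X k) :
  chain_map k.-1 (boundary X k c) = boundary Y k (chain_map k c).
Proof.
case: k c => [|k] c; first by rewrite /= linear0.
rewrite /chain_map /boundary.
elim/freeg_ind_dom0: c => [|a s D _ _ IH]; first by rewrite !linear0.
rewrite !linearD IH; congr (_ + _); rewrite /= !liftU !linearZ /= !liftU.
rewrite scale1r !linear_sum; apply: eq_bigr => i _ /=; congr (_ *: _).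
rewrite linearZ /= liftU scale1r; congr (_ *: Freeg [:: (_, _)]).
exact/continuousEP.
Qed.

Definition singular_homology_map k :
    {linear singular_homology X k -> singular_homology Y k} :=
  homology_map (@chain_map_boundary k.+1) (@chain_map_boundary k).

End SingularHomology.

Section Smooth.
Variables (R : realType) (m p : nat).
Local Notation V := 'rV[R]_m.
Local Notation W := 'rV[R]_p.

(* Iterated partial derivatives, the last element of s being applied first. *)
Fixpoint iter_partial (s : seq 'I_m) (g : V -> W) : V -> W :=
  if s is i :: s' then fun x => 'D_(delta_mx 0 i) (iter_partial s' g) x else g.

Definition smooth_on (U : set V) (g : V -> W) : Prop :=
  forall s x, U x -> differentiable (iter_partial s g) x.

Variable A : set V.

(* Smoothness on a subset A which need not be open: near each point, f is the
   restriction of a smooth map defined on an open subset of the ambient space. *)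
Definition local_extension (f : A -> W) (x : V) (g : V -> W) : Prop :=
  exists U : set V, [/\ open U, U x, smooth_on U g &
    forall q : A, U (val q) -> g (val q) = f q].

Definition smooth (f : A -> W) : Prop :=
  forall q : A, exists g, local_extension f (val q) g.

(* Derivatives of f : A -> W are those of a local extension. When A is the
   closure of its interior, as for an ellipsoid, they do not depend on the
   extension: see partialE and differentialE. *)
Definition germ (f : A -> W) (q : A) : V -> W :=
  xget (cst 0) [set g | local_extension f (val q) g].

Definition partial (s : seq 'I_m) (f : A -> W) (q : A) : W :=
  iter_partial s (germ f q) (val q).

Definition differential (f : A -> W) (q : A) : V -> W :=
  'd (germ f q) (val q).

Definition smooth_embedding (f : A -> W) : Prop :=
  [/\ smooth f, injective f, forall q, injective (differential f q) &
      forall U : set A, open U -> exists2 O : set W, open O & U = f @^-1` O].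

Lemma iter_partial_eq (U : set V) (g h : V -> W) s :
  open U -> {in U, g =1 h} -> {in U, iter_partial s g =1 iter_partial s h}.
Proof.
move=> oU gh; elim: s => //= i s IH x; rewrite inE => Ux.
apply: near_eq_derive; near=> y; apply: IH; rewrite inE; near: y.
exact: open_nbhs_nbhs.
Unshelve. all: by end_near. Qed.

Lemma linear_delta_eq (L M : {linear V -> W}) :
  (forall i, L (delta_mx 0 i) = M (delta_mx 0 i)) -> L =1 M.
Proof.
move=> LM v; rewrite (row_sum_delta v) (linear_sum L) (linear_sum M).
by apply: eq_bigr => i _; rewrite !linearZ /= LM.
Qed.

Hypothesis regA : A `<=` closure A^°.

Lemma local_extension_partial f (q : A) g h s :
  local_extension f (val q) g -> local_extension f (val q) h ->
  iter_partial s g (val q) = iter_partial s h (val q).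
Proof.
move=> [U [oU Uq sg gf]] [U' [oU' Uq' sh hf]].
pose O := U `&` U' `&` A^°.
have oO : open O.
  by apply: openI; [exact: openI|exact: open_interior].
have ghO : {in O, g =1 h}.
  move=> x; rewrite inE => -[[Ux U'x] /interior_subset Ax].
  have := gf (exist _ x (mem_set Ax)) Ux.
  by rewrite /= => ->; rewrite -(hf (exist _ x (mem_set Ax))).
have := iter_partial_eq s oO ghO => eqO.
apply/eqP; rewrite -subr_eq0; apply/negPn/negP => dne0.
pose D := iter_partial s g - iter_partial s h.
have cD : {for val q, continuous D}.
  apply: differentiable_continuous; apply: differentiableB.
    exact: sg.
  exact: sh.
have nD : nbhs (val q) (D @^-1` [set w | w != 0]).
  apply: cD; apply: open_nbhs_nbhs; split => //.
  rewrite (_ : [set w | w != 0] = ~` [set 0]); last first.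
    by apply/seteqP; split => w /= /eqP.
  apply: closed_openC.
  exact: accessible_closed_set1 (hausdorff_accessible (@norm_hausdorff _ _)) _.
have nU : nbhs (val q) (U `&` U').
  by apply: open_nbhs_nbhs; split => //; exact: openI.
have [x [Ax [/= Dx UUx]]] := regA (set_valP q) (filterI nD nU).
by move/eqP: Dx; apply; apply/eqP; rewrite subr_eq0 eqO// inE.
Qed.

Lemma germP f (q : A) g : local_extension f (val q) g ->
  local_extension f (val q) (germ f q).
Proof. by move=> fg; apply: (xgetPex _ (ex_intro _ g fg)). Qed.

Lemma partialE s f (q : A) g : local_extension f (val q) g ->
  partial s f q = iter_partial s g (val q).
Proof. by move=> fg; apply: local_extension_partial (germP fg) fg. Qed.

Lemma differentialE f (q : A) g : local_extension f (val q) g ->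
  differential f q = 'd g (val q) :> (V -> W).
Proof.
move=> fg; have gg := germP fg; apply/funext => v; rewrite /differential.
have df (h : V -> W) : local_extension f (val q) h -> differentiable h (val q).
  by move=> [U [_ Uq sh _]]; exact: (sh [::]).
apply: linear_delta_eq => i.
apply: etrans (esym (deriveE _ (df _ gg))) _.
apply: etrans (local_extension_partial [:: i] gg fg) _.
exact: deriveE (df _ fg).
Qed.

End Smooth.

Section RealContinuity.
Variables (R : realType) (T : topologicalType).
Implicit Types f g : T -> R.

Lemma cont_cst (x : R) : continuous (fun _ : T => x).
Proof. by move=> t; exact: cvg_cst. Qed.

Lemma cont_add f g : continuous f -> continuous g ->
  continuous (fun t => f t + g t).
Proof. by move=> cf cg t; apply: cvgD; [exact: cf|exact: cg]. Qed.

Lemma cont_sub f g : continuous f -> continuous g ->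
  continuous (fun t => f t - g t).
Proof. by move=> cf cg t; apply: cvgB; [exact: cf|exact: cg]. Qed.

Lemma cont_mul f g : continuous f -> continuous g ->
  continuous (fun t => f t * g t).
Proof. by move=> cf cg t; apply: cvgM; [exact: cf|exact: cg]. Qed.

Lemma cont_sum (I : finType) (f : I -> T -> R) :
  (forall i, continuous (f i)) -> continuous (fun t => \sum_i f i t).
Proof.
move=> cf; rewrite -[X in continuous X]fct_sumE.
by elim/big_ind: _ => [|g h cg ch|//]; [exact: cont_cst|exact: cont_add].
Qed.

End RealContinuity.

Section Ellipsoid.
Variables (R : realType) (n : nat).
Local Notation V := 'rV[R]_(n + n).
Implicit Types (z u v : V) (i : 'I_n) (a b : 'I_n -> R).

(* C^n is R^(2n) with coordinates (x_1, .., x_n, y_1, .., y_n), and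
   z_j = x_j + i y_j. *)
Definition re z i : R := z ord0 (lshift n i).
Definition im z i : R := z ord0 (rshift n i).

Definition ellipsoid_fun a z : R :=
  \sum_i pi * (re z i ^+ 2 + im z i ^+ 2) / a i.

Definition ellipsoid a : set V := [set z | ellipsoid_fun a z <= 1].

Arguments ellipsoid : clear implicits.

(* The constant 2-form d(1/2 sum_j (x_j dy_j - y_j dx_j)), that is,
   sum_j dx_j /\ dy_j. *)
Definition symp_form u v : R := \sum_i (re u i * im v i - im u i * re v i).

Definition symplectic (A : set V) (f : A -> V) : Prop :=
  forall q u v,
    symp_form (differential f q u) (differential f q v) = symp_form u v.

Record SympEmb a b := MkSympEmb {
  sympemb_fun :> ellipsoid a -> V;
  sympemb_embedding : smooth_embedding sympemb_fun;
  sympemb_interior : forall q, (ellipsoid b)^° (sympemb_fun q);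
  sympemb_symplectic : symplectic sympemb_fun }.

HB.instance Definition _ a b := gen_eqMixin (SympEmb a b).
HB.instance Definition _ a b := gen_choiceMixin (SympEmb a b).

(* The C^infinity compact-open topology is the coarsest one such that each
   partial derivative, of any order, is a continuous map into the functions on
   the ellipsoid with the compact-open topology. *)
Definition sympemb_jet a b (f : SympEmb a b) :
    prod_topology (fun _ : seq 'I_(n + n) => {compact-open, ellipsoid a -> V}) :=
  fun s => partial s f.

HB.instance Definition _ a b :=
  Topological.copy (SympEmb a b) (initial_topology (@sympemb_jet a b)).

Lemma ellipsoid_fun_continuous a : continuous (ellipsoid_fun a).
Proof.
apply: cont_sum => i; apply: cont_mul; last exact: cont_cst.
apply: cont_mul; first exact: cont_cst.
by apply: cont_add; apply: cont_mul; exact: coord_continuous.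
Qed.

Lemma ellipsoid_interior a z : ellipsoid_fun a z < 1 -> (ellipsoid a)^° z.
Proof.
move=> z1; apply: (@filterS _ _ _ [set y | ellipsoid_fun a y < 1]).
  by move=> y /ltW.
exact: (@ellipsoid_fun_continuous a z _ (lt_nbhsl z1)).
Qed.

Lemma ellipsoid_regular a : ellipsoid a `<=` closure (ellipsoid a)^°.
Proof.
move=> z za B Bz.
have cz : (fun t : R => t *: z) t @[t --> 1^'-] --> z.
  rewrite -[X in _ --> X]scale1r; apply: cvg_at_left_filter.
  exact: scalel_continuous.
near ((1 : R)^'-) => t.
have t0 : 0 < t by near: t; exact: nbhs_left_gt.
have t1 : t < 1 by near: t; exact: nbhs_left_lt.
exists (t *: z); split; last by near: t; exact: cz.
apply: ellipsoid_interior.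
have -> : ellipsoid_fun a (t *: z) = t ^+ 2 * ellipsoid_fun a z.
  rewrite /ellipsoid_fun mulr_sumr; apply: eq_bigr => i _.
  by rewrite /re /im !mxE; ring.
have : t ^+ 2 < 1 by rewrite expr_lt1// ltW.
have : 0 < t ^+ 2 by rewrite exprn_gt0.
by move: za; rewrite /ellipsoid /=; nra.
Unshelve. all: by end_near. Qed.

Section Rotation.
Variables (c s : 'I_n -> R).

(* z_j |-> (c_j + i s_j) z_j *)
Definition rotation z : V :=
  row_mx (\row_i (c i * re z i - s i * im z i))
         (\row_i (s i * re z i + c i * im z i)).

Lemma re_rotation z i : re (rotation z) i = c i * re z i - s i * im z i.
Proof. by rewrite /re /rotation row_mxEl mxE. Qed.

Lemma im_rotation z i : im (rotation z) i = s i * re z i + c i * im z i.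
Proof. by rewrite /im /rotation row_mxEr mxE. Qed.

Lemma reimP u v : (forall i, re u i = re v i) -> (forall i, im u i = im v i) ->
  u = v.
Proof.
move=> uvr uvi; apply/rowP => j.
by case: (split_ordP j) => i ->; [exact: uvr|exact: uvi].
Qed.

Lemma rotation_linear : linear rotation.
Proof.
have reP k u v i : re (k *: u + v) i = k * re u i + re v i.
  by rewrite /re !mxE.
have imP k u v i : im (k *: u + v) i = k * im u i + im v i.
  by rewrite /im !mxE.
move=> k u v; apply: reimP => i.
  by rewrite reP !re_rotation reP imP; ring.
by rewrite imP !im_rotation reP imP; ring.
Qed.

HB.instance Definition _ := GRing.isLinear.Build R V V _ rotation rotation_linear.

End Rotation.

Lemma rotation_joint_continuous (T : topologicalType) (c s : T -> 'I_n -> R)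
    (z : T -> V) :
  (forall i, continuous (fun t => c t i)) ->
  (forall i, continuous (fun t => s t i)) -> continuous z ->
  continuous (fun t => rotation (c t) (s t) (z t)).
Proof.
move=> cc sc zc; apply: mx_continuous => i j; rewrite (ord1 i).
have zjc k : continuous (fun t => z t ord0 k).
  move=> t; apply: (@continuous_comp T V R z (fun M : V => M ord0 k)).
    exact: zc.
  exact: coord_continuous.
case: (split_ordP j) => k ->.
  under eq_fun do rewrite -/(re _ _) re_rotation.
  by apply: cont_sub; apply: cont_mul; (exact: cc || exact: sc || exact: zjc).
under eq_fun do rewrite -/(im _ _) im_rotation.
by apply: cont_add; apply: cont_mul; (exact: cc || exact: sc || exact: zjc).
Qed.

Lemma rotation_continuous c s : continuous (rotation c s).
Proof.
apply: (@rotation_joint_continuous V (fun=> c) (fun=> s) id) => [i|i|z].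
- exact: cont_cst.
- exact: cont_cst.
- exact: cvg_id.
Qed.

Lemma iter_partial_rotation c s l :
  iter_partial l (rotation c s) = fun z =>
    match l with
    | [::] => rotation c s z
    | [:: j] => rotation c s (delta_mx 0 j)
    | _ => 0
    end.
Proof.
elim: l => [//|j l IH]; apply/funext => z /=; rewrite IH {IH}.
case: l => [|k [|? l]] /=.
- rewrite deriveE; last exact/linear_differentiable/rotation_continuous.
  by rewrite diff_lin//; exact: rotation_continuous.
- exact: derive_cst.
- exact: derive_cst.
Qed.

Lemma rotation_smooth c s U : smooth_on U (rotation c s).
Proof.
move=> l z _; rewrite iter_partial_rotation.
case: l => [|k [|? l]]; last 2 first.
- exact: differentiable_cst.
- exact: differentiable_cst.
exact/linear_differentiable/rotation_continuous.
Qed.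

Definition rotation_on a c s (q : ellipsoid a) : V := rotation c s (val q).

Lemma rotation_extension a c s (q : ellipsoid a) :
  local_extension (@rotation_on a c s) (val q) (rotation c s).
Proof.
by exists setT; split=> //; [exact: openT|exact: rotation_smooth].
Qed.

Lemma rotation_partial a c s l (q : ellipsoid a) :
  partial l (@rotation_on a c s) q =
    match l with
    | [::] => rotation c s (val q)
    | [:: j] => rotation c s (delta_mx 0 j)
    | _ => 0
    end.
Proof.
rewrite (partialE (@ellipsoid_regular a) l (rotation_extension c s q)).
by rewrite iter_partial_rotation.
Qed.

Lemma rotation_differential a c s (q : ellipsoid a) :
  differential (@rotation_on a c s) q = rotation c s.
Proof.
rewrite (differentialE (@ellipsoid_regular a) (rotation_extension c s q)).
by rewrite diff_lin//; exact: rotation_continuous.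
Qed.

Section Unitary.
Variables (c s : 'I_n -> R).
Hypothesis cs1 : forall i, c i ^+ 2 + s i ^+ 2 = 1.

Lemma rotationK : cancel (rotation c s) (rotation c (fun i => - s i)).
Proof.
move=> z; apply: reimP => i;
  rewrite ?re_rotation ?im_rotation ?re_rotation ?im_rotation.
  transitivity ((c i ^+ 2 + s i ^+ 2) * re z i); first ring.
  by rewrite cs1 mul1r.
transitivity ((c i ^+ 2 + s i ^+ 2) * im z i); first ring.
by rewrite cs1 mul1r.
Qed.

Lemma rotation_embedding a : smooth_embedding (@rotation_on a c s).
Proof.
split.
- by move=> q; exists (rotation c s); exact: rotation_extension.
- by move=> q q1 /(can_inj rotationK) /val_inj.
- by move=> q; rewrite rotation_differential; exact: can_inj rotationK.
- move=> U [G oG <-].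
  exists ((rotation c (fun i => - s i)) @^-1` G).
    by apply: open_comp => // z _; exact: rotation_continuous.
  by apply/seteqP; split => q /=; rewrite /rotation_on rotationK.
Qed.

Lemma rotation_symplectic a : symplectic (@rotation_on a c s).
Proof.
move=> q u v; rewrite rotation_differential; apply: eq_bigr => i _.
rewrite !re_rotation !im_rotation.
transitivity ((c i ^+ 2 + s i ^+ 2) * (re u i * im v i - im u i * re v i)).
  ring.
by rewrite cs1 mul1r.
Qed.

Lemma ellipsoid_fun_rotation a z :
  ellipsoid_fun a (rotation c s z) = ellipsoid_fun a z.
Proof.
apply: eq_bigr => i _; congr (_ * _ / _); rewrite re_rotation im_rotation.
transitivity ((c i ^+ 2 + s i ^+ 2) * (re z i ^+ 2 + im z i ^+ 2)); first ring.
by rewrite cs1 mul1r.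
Qed.

Lemma rotation_interior a b (a0 : forall i, 0 < a i) (ab : forall i, a i < b i)
  (q : ellipsoid a) : (ellipsoid b)^° (rotation_on c s q).
Proof.
apply: ellipsoid_interior; rewrite /rotation_on ellipsoid_fun_rotation.
have qa : ellipsoid_fun a (val q) <= 1 := set_valP q.
set z := val q in qa *.
pose N i := re z i ^+ 2 + im z i ^+ 2.
have N0 i : 0 <= N i by rewrite addr_ge0 ?sqr_ge0.
have b0 i : 0 < b i := lt_trans (a0 i) (ab i).
have piN0 i : 0 <= pi * N i by rewrite mulr_ge0 ?pi_ge0.
have le_ba i : pi * N i / b i <= pi * N i / a i.
  by rewrite ler_wpM2l// lef_pV2 ?posrE// ltW.
have [zN|/existsNP[i /eqP Ni]] := pselect (forall i, N i = 0).
  rewrite /ellipsoid_fun big1 ?ltr01// => i _.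
  by rewrite -/(N i) zN mulr0 mul0r.
apply: lt_le_trans qa; rewrite /ellipsoid_fun (bigD1 i)//= [ltRHS](bigD1 i)//=.
apply: ltr_leD; last by apply: ler_sum => j _; exact: le_ba.
rewrite ltr_pM2l ?ltf_pV2 ?posrE//.
by rewrite mulr_gt0 ?pi_gt0// lt_neqAle eq_sym Ni N0.
Qed.

End Unitary.

End Ellipsoid.

Section Torus.
Variable R : realType.

Definition two_piZ : {pred R} :=
  [pred t | `[< exists m : int, t = (pi *+ 2) *~ m >]].

Lemma two_piZ_zmod_closed : zmod_closed two_piZ.
Proof.
split=> [|x y]; first by apply/asboolP; exists 0; rewrite mulr0z.
move=> /asboolP[m ->] /asboolP[l ->]; apply/asboolP.
by exists (m - l); rewrite mulrzBr.
Qed.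

HB.instance Definition _ :=
  GRing.isZmodClosed.Build R two_piZ two_piZ_zmod_closed.

(* R / 2 pi Z *)
Definition angle : topologicalType :=
  quotient_topology (Quotient.quot two_piZ).

Definition torus (n : nat) : topologicalType :=
  prod_topology (fun _ : 'I_n => angle).

Definition angle_repr (t : angle) : R := repr t.

Lemma periodicz (f : R -> R) T : periodic f T ->
  forall (m : int) x, f (x + T *~ m) = f x.
Proof.
move=> fT [m|m] x; first exact: periodicn.
by rewrite -[LHS](periodicn fT m.+1) NegzE mulrNz -pmulrn subrK.
Qed.

Lemma angle_continuous (f : R -> R) : continuous f -> periodic f (pi *+ 2) ->
  continuous (f \o angle_repr).
Proof.
move=> cf fT; apply: repr_comp_continuous => // x y.
move=> /eqP xy.
have /eqP : \pi_(Quotient.quot two_piZ)%qT x = \pi_(Quotient.quot two_piZ)%qT y.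
  exact: xy.
rewrite -Quotient.idealrBE => /asboolP[m {}xy]; apply/eqP.
by rewrite -[x](subrK y) xy addrC periodicz.
Qed.

Variable n : nat.

Definition torus_cos (t : torus n) (i : 'I_n) : R := cos (angle_repr (t i)).
Definition torus_sin (t : torus n) (i : 'I_n) : R := sin (angle_repr (t i)).

Lemma torus_cos2Dsin2 t i : torus_cos t i ^+ 2 + torus_sin t i ^+ 2 = 1.
Proof. exact: cos2Dsin2. Qed.

Lemma torus_proj_continuous (f : angle -> R) i : continuous f ->
  continuous (fun t : torus n => f (t i)).
Proof.
move=> cf t; apply: (@continuous_comp (torus n) angle R (fun u => u i) f).
  exact: (@proj_continuous _ (fun _ : 'I_n => angle)).
exact: cf.
Qed.

Lemma torus_cos_continuous i : continuous (fun t => torus_cos t i).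
Proof.
by apply: (@torus_proj_continuous (cos \o angle_repr));
  apply: angle_continuous; [exact: continuous_cos|exact: cosD2pi].
Qed.

Lemma torus_sin_continuous i : continuous (fun t => torus_sin t i).
Proof.
by apply: (@torus_proj_continuous (sin \o angle_repr));
  apply: angle_continuous; [exact: continuous_sin|exact: sinD2pi].
Qed.

(* U_t (z_1, .., z_n) = (e^(i t_1) z_1, .., e^(i t_n) z_n) *)
Definition unitary_map (t : torus n) : 'rV[R]_(n + n) -> 'rV[R]_(n + n) :=
  rotation (torus_cos t) (torus_sin t).

Variables (a b : 'I_n -> R).
Hypotheses (a_gt0 : forall i, 0 < a i) (lt_ab : forall i, a i < b i).

Definition Phi_fun (t : torus n) : SympEmb a b :=
  @MkSympEmb R n a b (fun q => unitary_map t (val q))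
    (rotation_embedding (torus_cos2Dsin2 t) a)
    (rotation_interior (torus_cos2Dsin2 t) a_gt0 lt_ab)
    (@rotation_symplectic R n _ _ (torus_cos2Dsin2 t) a).

Lemma Phi_continuous : continuous Phi_fun.
Proof.
apply: continuous_comp_initial => t.
apply/cvg_sup => [|s]; first exact/fmap_filter/nbhs_filter.
move: t; apply: (@continuous_comp_initial
  (prod_topology (fun _ : seq 'I_(n + n) =>
     {compact-open, ellipsoid a -> 'rV[R]_(n + n)})) (torus n) _ (@^~ s)).
pose g (x : torus n * ellipsoid a) : 'rV[R]_(n + n) :=
  match s with
  | [::] => unitary_map x.1 (val x.2)
  | [:: j] => unitary_map x.1 (delta_mx 0 j)
  | _ => 0
  end.
rewrite [X in continuous X](_ : _ = curry g); last first.
  by apply/funext => t; apply/funext => q; exact: rotation_partial.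
apply: continuous_curry_fun.
have c1 i : continuous (fun x : torus n * ellipsoid a => torus_cos x.1 i).
  move=> x; apply: (@continuous_comp _ _ _ fst (fun t => torus_cos t i)).
    exact: cvg_fst.
  exact: torus_cos_continuous.
have s1 i : continuous (fun x : torus n * ellipsoid a => torus_sin x.1 i).
  move=> x; apply: (@continuous_comp _ _ _ fst (fun t => torus_sin t i)).
    exact: cvg_fst.
  exact: torus_sin_continuous.
rewrite /g; case: (s) => [|j [|? ?]].
- apply: rotation_joint_continuous => // x.
  apply: (@continuous_comp _ _ _ snd (fun q : ellipsoid a => val q)).
    exact: cvg_snd.
  exact: initial_continuous.
- apply: rotation_joint_continuous => // x; exact: cvg_cst.
- move=> x; exact: cvg_cst.
Qed.

Definition Phi : continuousType (torus n) (SympEmb a b) :=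
  mkcts Phi_continuous.

End Torus.

Lemma lt_pointwise (R : realType) (n : nat) (a b : 'I_n.+1 -> R) :
  {homo a : i j / (i <= j)%N >-> i <= j} ->
  {homo b : i j / (i <= j)%N >-> i <= j} ->
  a ord_max < b ord0 -> forall i, a i < b i.
Proof.
move=> a_nd b_nd ab i; apply: le_lt_trans (lt_le_trans ab _).
  by apply: a_nd; exact: leq_ord.
exact: b_nd.
Qed.

(* Main.v *)
Require Import Defs.
From HB Require Import structures.
From mathcomp Require Import all_boot all_order all_algebra.
From mathcomp Require Import generic_quotient ring_quotient.
From mathcomp Require Import all_classical all_reals all_analysis.
From mathcomp Require Import ring lra zify.
From mathcomp.multinomials Require Import freeg.
From mathcomp.real_closed Require Import complex.

(* Since a_n < b_1, every unitary map of C^n sends E(a) into the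
   interior of E(b), so Phi factors through U(n).  Conjugating coordinate
   rotations (Whitehead's lemma) gives a homotopy from diag(z_1, .., z_n) to
   diag(z_1 ... z_n, 1, .., 1), so Phi is homotopic to a map which factors
   through the circle, T^n -> S^1 -> SympEmb.  This bounds the rank by that of
   H_k(S^1), which is computed from the covering R -> S^1: for the translation
   tau by 2 pi, 0 -> C(R) -1-tau-> C(R) -> C(S^1) -> 0 is exact and R is
   contractible.  In degree 1 the rank is not 0, because the phase of the
   complex determinant of the complex linear part of the differential at 0
   (which does not vanish on symplectic matrices) is a continuous map
   SympEmb -> S^1 whose composition with Phi is the product T^n -> S^1. *)

Set Implicit Arguments.
Unset Strict Implicit.
Unset Printing Implicit Defensive.

Import Order.TTheory GRing.Theory Num.Theory.
Import numFieldNormedType.Exports.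

Local Open Scope classical_set_scope.
Local Open Scope ring_scope.

(** * Singular chains *)

(** A simplex is compact and contractible, so every singular simplex of the circle lifts to the
    line, uniquely up to a multiple of 2 pi. The sequence of the covering can therefore be used
    chain by chain, with no subdivision of simplices. Cones along an explicit contraction serve
    twice: they make the line acyclic, and they supply the prisms behind homotopy invariance. The
    topology of [SympEmb] controls derivatives of every order on compact sets. Maps into it are easy
    to handle here because they take linear values, whose derivatives of order two and more vanish;
    the map out of it reads only first derivatives at one point. The complex linear part is
    preferred to the unitary factor of the polar decomposition because it is linear in the
    differential, which makes its determinant visibly continuous. The phase of [Phi] equals the
    product of the phases exactly, not just up to homotopy, so one loop of the torus, along which
    only the first angle turns, settles degree 1. In degree 0 the augmentation does the work of the
    phase. The argument runs over an arbitrary field. *)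

Section FreegMaps.
Variables (F : fieldType) (K : choiceType) (M : lmodType F).

Lemma freegUZ (a : F) (x : K) : << a *g x >> = a *: << x >>.
Proof. by apply/eqP/freeg_eqP => t; rewrite coeffZ !coeffU mul1r. Qed.

Lemma eq_linear_freeg (f g : {linear {freeg K / F} -> M}) :
  (forall x, f << x >> = g << x >>) -> f =1 g.
Proof.
move=> fg; elim/freeg_ind_dom0 => [|a x D _ _ IH]; first by rewrite !linear0.
by rewrite !linearD IH freegUZ !linearZ /= fg.
Qed.

Lemma fgliftU (f : K -> M) x : fglift f << x >> = f x.
Proof. by rewrite liftU scale1r. Qed.

End FreegMaps.

Section Faces.
Variable R : realType.
Local Notation Simplex k := (@simplex R k).

Lemma simplex_eq k (t u : Simplex k) :
  (forall j, val t ord0 j = val u ord0 j) -> t = u.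
Proof. by move=> tu; apply/val_inj/rowP. Qed.

Lemma face_vecE k (i : 'I_k.+2) (t : 'rV[R]_k.+1) (j : 'I_k.+2) :
  face_vec i t ord0 j =
    if j == i then 0 else t ord0 (inord (unbump i j)).
Proof.
rewrite mxE; case: unliftP => [l ->|->]; last by rewrite eqxx.
rewrite eq_sym (negbTE (neq_lift i l)); congr (t _ _).
by apply/val_inj; rewrite /= inordK ?bumpK.
Qed.

(** The cosimplicial identity behind the vanishing of the double boundary; the [inord] only carry
    indices between ordinal types of different sizes. *)
Lemma face_face k (i : 'I_k.+3) (j : 'I_k.+2) (t : Simplex k) : (j < i)%N ->
  face_fun i (face_fun j t) = face_fun (inord j) (face_fun (inord i.-1) t).
Proof.
move=> ji; apply: simplex_eq => l; have li := ltn_ord i; have ll := ltn_ord l.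
have lj := ltn_ord j.
have jK : (inord j : 'I_k.+3) = j :> nat by rewrite inordK; lia.
have iK : (inord i.-1 : 'I_k.+2) = i.-1 :> nat by rewrite inordK; lia.
rewrite /= !face_vecE -!val_eqE /= jK iK /unbump.
case: (ltngtP l i) => li1; case: (ltngtP l j) => lj1; do ?[lia];
  rewrite ?subn0 ?subn1 ?inordK; do ?[lia]; do ?case: ifPn; try lia; move=> *;
  try exact: erefl; congr (sval t _ _); apply/val_inj; rewrite /= !inordK; lia.
Qed.

End Faces.

Section ChainComplex.
Variables (R : realType) (F : fieldType).
Local Notation Simplex k := (@simplex R k).
Local Notation C X k := (chain R F X k).

Lemma eq_chain (X : topologicalType) k (M : lmodType F)
    (f g : {linear C X k -> M}) :
  (forall s : singular_simplex R X k, f << s >> = g << s >>) -> f =1 g.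
Proof. exact: eq_linear_freeg. Qed.

Lemma boundary_simplex (X : topologicalType) k (s : singular_simplex R X k.+1) :
  boundary R F X k.+1 << s >> =
  \sum_(i < k.+2) (-1) ^+ i *: << (s \o face R i : continuousType _ _) >>.
Proof. exact: fgliftU. Qed.

Lemma chain_map_simplex (X Y : topologicalType) (f : continuousType X Y) k
    (s : singular_simplex R X k) :
  chain_map R F f k << s >> = << (f \o s : continuousType _ _) >>.
Proof. exact: fgliftU. Qed.

Lemma chain_map_comp (X Y Z : topologicalType) (f : continuousType X Y)
    (g : continuousType Y Z) k (c : C X k) :
  chain_map R F g k (chain_map R F f k c) =
  chain_map R F (g \o f : continuousType _ _) k c.
Proof.
move: c; apply: (@eq_chain _ _ _
  (chain_map R F g k \o chain_map R F f k)) => s /=.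
by rewrite /= !chain_map_simplex; congr << _ >>; apply/continuousEP.
Qed.

Lemma boundary_boundary (X : topologicalType) k (c : C X k.+1) :
  boundary R F X k (boundary R F X k.+1 c) = 0.
Proof.
case: k c => [//|k]; apply: (@eq_chain _ _ _
  (boundary R F X k.+1 \o boundary R F X k.+2) \0) => s /=.
rewrite boundary_simplex linear_sum /=.
under eq_bigr => i _ do rewrite linearZ /= boundary_simplex scaler_sumr.
pose G (p : 'I_k.+3 * 'I_k.+2) : C X k :=
  << (s \o face R p.1 \o face R p.2 : continuousType _ _) >>.
rewrite pair_bigA /= (eq_bigr (fun p : 'I_k.+3 * 'I_k.+2 =>
  (-1) ^+ (p.1 + p.2) *: G p)); last first.
  by move=> p _; rewrite scalerA exprD.
rewrite (bigID (fun p : 'I_k.+3 * 'I_k.+2 => p.2 < p.1)%N) /=.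
(* The pairs with [i <= j] are matched with the others by [(i, j) |-> (j.+1, i)]: by [face_face]
   both give the same iterated face, with opposite signs. *)
pose h (p : 'I_k.+3 * 'I_k.+2) : 'I_k.+3 * 'I_k.+2 := (inord p.2.+1, inord p.1).
pose h' (p : 'I_k.+3 * 'I_k.+2) : 'I_k.+3 * 'I_k.+2 := (inord p.2, inord p.1.-1).
rewrite (reindex_onto h h') /=; last first.
  move=> -[i j] /= ji; rewrite /h /h' /=; have := ltn_ord i => li.
  by congr (_, _); apply/val_inj; rewrite /= !inordK; lia.
rewrite (eq_bigl (fun p : 'I_k.+3 * 'I_k.+2 => ~~ (p.2 < p.1)%N)); last first.
  move=> -[i j] /=; have := ltn_ord j; have := ltn_ord i => li lj.
  apply/idP/idP.
    rewrite /h /h' /=; move: (inord i) => m; have lm := ltn_ord m.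
    move=> /andP[+ /eqP[/(congr1 val)/= + _]].
    by rewrite !inordK; lia.
  move=> ij; rewrite /h /h' /= -pair_eqE /= -!val_eqE /= !inordK; lia.
rewrite -big_split big1//= => -[i j] /= ij.
have li := ltn_ord i; have lj := ltn_ord j.
rewrite !inordK; [|lia..].
have -> : G (inord j.+1, inord i) = G (i, j).
  rewrite /G; congr << _ >>; apply/continuousEP => t.
  congr (s _); change (face_fun (inord j.+1) (face_fun (inord i) t) = face_fun i (face_fun j t)).
  rewrite face_face; last by rewrite !inordK; lia.
  by congr (face_fun _ (face_fun _ _)); apply/val_inj; rewrite /= !inordK //=; lia.
by rewrite addSn [in (j + i)%N]addnC exprS mulN1r scaleNr addNr.
Qed.

End ChainComplex.

(** * Cones and homotopies *)

(** Pointwise form of [continuous_comp_initial], needed because the radial projection of a simplex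
    is handled only away from its vertex. *)
Lemma continuous_at_initial (Y : choiceType) (X Z : topologicalType) (w : Y -> Z)
    (f : X -> initial_topology w) x :
  {for x, continuous (w \o f)} -> {for x, continuous f}.
Proof.
move=> cf U [V [[W oW <-] Wx VU]]; apply: filterS VU _.
by apply: cf; exact: open_nbhs_nbhs.
Qed.

Lemma continuous_at_pair (T U V : topologicalType) (f : T -> U) (g : T -> V) t :
  {for t, continuous f} -> {for t, continuous g} ->
  {for t, continuous (fun u => (f u, g u))}.
Proof.
move=> fc gc W [[A B] /= [Af Bg] AB].
have fA : nbhs t (f @^-1` A) := fc _ Af.
have gB : nbhs t (g @^-1` B) := gc _ Bg.
change (nbhs t ((fun u => (f u, g u)) @^-1` W)).
apply: filterS (filterI fA gB) => u [Au Bu].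
exact: (AB (f u, g u)).
Qed.

Lemma continuous_pair (T U V : topologicalType) (f : T -> U) (g : T -> V) :
  continuous f -> continuous g -> continuous (fun u => (f u, g u)).
Proof. by move=> fc gc t; apply: continuous_at_pair; [exact: fc|exact: gc]. Qed.

Lemma continuous_compose (T U V : topologicalType) (g : U -> V) (f : T -> U) :
  continuous g -> continuous f -> continuous (fun t => g (f t)).
Proof. by move=> gc fc t; apply: continuous_comp; [exact: fc|exact: gc]. Qed.

Lemma continuous_fst (T U : topologicalType) : continuous (@fst T U).
Proof. by move=> t; exact: cvg_fst. Qed.

Lemma continuous_snd (T U : topologicalType) : continuous (@snd T U).
Proof. by move=> t; exact: cvg_snd. Qed.

Lemma near_continuous_at (T U : topologicalType) (f g : T -> U) t :
  nbhs t [set u | f u = g u] -> {for t, continuous g} -> {for t, continuous f}.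
Proof.
move=> fg gc W; rewrite (nbhs_singleton fg) => Wg.
have gW : nbhs t (g @^-1` W) := gc _ Wg.
change (nbhs t (f @^-1` W)).
by apply: filterS (filterI fg gW) => u [/= ->].
Qed.

Lemma continuous_at_div (R : realType) (T : topologicalType) (f g : T -> R) t :
  g t != 0 -> {for t, continuous f} -> {for t, continuous g} ->
  {for t, continuous (fun u => f u / g u)}.
Proof. by move=> gt fc gc; apply: cvgM => //; exact: cvgV. Qed.

Lemma mx_continuous_at (T U : topologicalType) m n (f : T -> 'M[U]_(m, n)) t :
  (forall i j, {for t, continuous (fun u => f u i j)}) -> {for t, continuous f}.
Proof.
move=> fc B [P Pnbhs PB]; apply: filterS PB _.
suff : \forall s \near t, forall ij : 'I_m * 'I_n, P ij.1 ij.2 (f s ij.1 ij.2).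
  by apply: filterS => s Ps i j; exact: (Ps (i, j)).
by apply: filter_forall => -[i j] /=; apply: fc; exact: Pnbhs.
Qed.

(** A filter on the subtype is pushed forward to [X], where compactness yields a cluster point in
    [A]; since the subtype carries the initial topology, this point is a cluster point of the
    original filter. *)
Lemma compact_set_type (X : topologicalType) (A : set X) :
  compact A -> compact [set: set_type A].
Proof.
move=> cA G GF _; have FF : ProperFilter (set_val @ G).
  exact: fmap_proper_filter.
have [|a [Aa Ga]] := cA _ FF.
  change (G (set_val @^-1` A)); rewrite (_ : _ @^-1` _ = setT); first exact: filterT.
  by apply/seteqP; split => // x _; exact: (set_valP x).
exists (exist _ a (mem_set Aa)); split => // B N GB.
move=> [V [[U oU <-] Ua VN]].
have GBA : (set_val @ G) (set_val @` B).
  change (G (set_val @^-1` (set_val @` B))); apply: filterS GB => b Bb.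
  by exists b.
have [_ [[b Bb <-] Ub]] := Ga _ U GBA (open_nbhs_nbhs (conj oU Ua)).
by exists b; split => //; exact: VN.
Qed.

Section SimplexTopology.
Variables (R : realType) (k : nat).
Local Notation Simplex k := (@simplex R k).

Lemma simplex_coord_continuous (j : 'I_k.+1) :
  continuous (fun t : Simplex k => val t ord0 j).
Proof.
move=> t; apply: (continuous_comp (g := fun M : 'rV[R]_k.+1 => M ord0 j)).
  exact: initial_continuous.
exact: coord_continuous.
Qed.

Lemma simplex_ge0 (t : Simplex k) j : 0 <= val t ord0 j.
Proof. by have [/(_ j)] := set_valP t. Qed.

Lemma simplex_sum (t : Simplex k) : \sum_j val t ord0 j = 1.
Proof. by have [] := set_valP t. Qed.

Lemma simplex_le1 (t : Simplex k) j : val t ord0 j <= 1.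
Proof.
rewrite -(simplex_sum t) (bigD1 j)//= lerDl sumr_ge0// => i _.
exact: simplex_ge0.
Qed.

Lemma compact_simplex : compact [set: Simplex k].
Proof.
apply: compact_set_type.
have cK : compact [set v : 'rV[R]_k.+1 | forall i, `[0, 1]%classic (v ord0 i)].
  by apply: (@rV_compact R _ (fun=> `[0, 1]%classic)) => i; exact: segment_compact.
apply: (subclosed_compact _ cK) => [|v [v0 v1] i]; last first.
  rewrite /= in_itv /= v0 -v1 (bigD1 i)//= lerDl sumr_ge0//.
rewrite (_ : Simplex k = (\bigcap_i [set v : 'rV[R]_k.+1 | 0 <= v ord0 i]) `&`
    [set v | \sum_i v ord0 i = 1]); last first.
  by apply/seteqP; split => v [v0 v1]; split => // i; [move=> _|]; exact: v0.
apply: closedI.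
  apply: closed_bigI => i _.
  apply: (@closed_comp _ _ (fun v : 'rV[R]_k.+1 => v ord0 i) [set x | 0 <= x]).
    by move=> v _; exact: coord_continuous.
  exact: closed_ge.
apply: (@closed_comp _ _ (fun v : 'rV[R]_k.+1 => \sum_i v ord0 i) [set x | x = 1]).
  by move=> v _; apply: cont_sum => i; exact: coord_continuous.
exact: closed_eq.
Qed.

Lemma vertex_subproof (i : 'I_k.+1) : (delta_mx 0 i : 'rV[R]_k.+1) \in Simplex k.
Proof.
rewrite inE; split => [j|]; first by rewrite mxE ler0n.
rewrite (bigD1 i)//= mxE !eqxx big1 ?addr0// => j /negbTE ji.
by rewrite mxE ji andbF.
Qed.

Definition vertex (i : 'I_k.+1) : Simplex k :=
  exist _ (delta_mx 0 i) (vertex_subproof i).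

End SimplexTopology.

Section Cone.
Variables (R : realType) (X : topologicalType) (g : X * R -> X) (x0 : X).
Hypotheses (gc : continuous g) (g0 : forall x, g (x, 0) = x).
Hypothesis (g1 : forall x, g (x, 1) = x0).
Local Notation Simplex k := (@simplex R k).

(* Radial projection of the simplex from its vertex 0 to the opposite face; at
   the vertex itself it takes a junk value. *)
Definition cone_proj k (t : Simplex k.+1) : Simplex k :=
  insubd (vertex R ord0)
    (\row_j (val t ord0 (fintype.lift ord0 j) / (1 - val t ord0 ord0))).

Lemma cone_projE k (t : Simplex k.+1) j : val t ord0 ord0 != 1 ->
  val (cone_proj t) ord0 j =
  val t ord0 (fintype.lift ord0 j) / (1 - val t ord0 ord0).
Proof.
move=> t1; rewrite insubdK ?mxE//.
have t0 : 0 < 1 - val t ord0 ord0.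
  by rewrite subr_gt0 lt_neqAle t1 simplex_le1.
rewrite inE; split => [i|].
  by rewrite mxE divr_ge0// ?simplex_ge0// ltW.
under eq_bigr do rewrite mxE.
rewrite -mulr_suml; apply: (canLR (mulfK (lt0r_neq0 t0))).
rewrite mul1r; apply/eqP; rewrite eq_sym subr_eq addrC -big_ord_recl.
by rewrite simplex_sum.
Qed.

(** The barycentric coordinate of vertex 0 serves as the time of the contraction [g]: the face
    opposite to that vertex carries [s], and the vertex goes to [x0]. *)
Definition cone_fun k (s : Simplex k -> X) (t : Simplex k.+1) : X :=
  if val t ord0 ord0 == 1 then x0 else g (s (cone_proj t), val t ord0 ord0).

(** The projection has no limit at the vertex. By compactness of the simplex, however, [g (s x, r)]
    tends to [x0] uniformly in [x] as [r] tends to 1, so the direction of approach does not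
    matter. *)
Lemma cone_continuous k (s : Simplex k -> X) :
  continuous s -> continuous (cone_fun s).
Proof.
move=> sc t; have [t1|t1] := eqVneq (val t ord0 ord0) 1.
  move=> W; rewrite /cone_fun t1 eqxx => Wx0.
  have W1 : \forall r \near (1 : R),
      [set: Simplex k] `<=` (fun x => W (g (s x, r))).
    apply: ((compact_near_coveringP _).1 (@compact_simplex R k) R (nbhs (1 : R))
      (fun r x => W (g (s x, r)))).
    move=> x _.
    have : continuous (fun p : Simplex k * R => g (s p.1, p.2)).
      apply: continuous_compose => //; apply: continuous_pair.
        by apply: continuous_compose => //; exact: continuous_fst.
      exact: continuous_snd.
    by move=> /(_ (x, 1)); apply; rewrite /= g1.
  have Wt : nbhs t ((fun u : Simplex k.+1 => val u ord0 ord0) @^-1`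
      [set r | [set: Simplex k] `<=` (fun x => W (g (s x, r)))]).
    by apply: simplex_coord_continuous; rewrite t1.
  change (nbhs t (cone_fun s @^-1` W)).
  apply: filterS Wt => u /= Wu; rewrite /cone_fun.
  case: ifPn => [_|_]; first exact: nbhs_singleton.
  exact: Wu.
have near1 : nbhs t (fun u : Simplex k.+1 => val u ord0 ord0 != 1).
  apply: (@simplex_coord_continuous R k.+1 ord0 t [set x | x != 1]).
  exact: (open_nbhs_nbhs (conj (@open_neq _ _) t1)).
apply: (@near_continuous_at _ _ _
    (fun u : Simplex k.+1 => g (s (cone_proj u), val u ord0 ord0))).
  by apply: filterS near1 => u /negbTE /= u1; rewrite /cone_fun u1.
apply: (@continuous_comp _ _ _
  (fun u : Simplex k.+1 => (s (cone_proj u), val u ord0 ord0)) g); last exact: gc.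
apply: continuous_at_pair; last exact: simplex_coord_continuous.
apply: (@continuous_comp _ _ _ (@cone_proj k) s); last exact: sc.
apply: continuous_at_initial => /=.
apply: mx_continuous_at => i j; rewrite (ord1 i).
apply: (@near_continuous_at _ _ _ (fun u : Simplex k.+1 =>
    val u ord0 (fintype.lift ord0 j) / (1 - val u ord0 ord0))).
  by apply: filterS near1 => u u1; exact: cone_projE.
apply: (@continuous_at_div R (Simplex k.+1)
  (fun u : Simplex k.+1 => val u ord0 (fintype.lift ord0 j))
  (fun u : Simplex k.+1 => 1 - val u ord0 ord0)).
- by rewrite subr_eq0 eq_sym.
- exact: simplex_coord_continuous.
- by apply: cont_sub; [exact: cont_cst|exact: simplex_coord_continuous].
Qed.

End Cone.

Section ConeChain.
Variables (R : realType) (F : fieldType).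
Variables (X : topologicalType) (g : X * R -> X) (x0 : X).
Hypotheses (gc : continuous g) (g0 : forall x, g (x, 0) = x).
Hypothesis (g1 : forall x, g (x, 1) = x0).
Local Notation Simplex k := (@simplex R k).
Local Notation C k := (chain R F X k).

Definition cone_simplex k (s : singular_simplex R X k) :
    singular_simplex R X k.+1 :=
  mkcts (cone_continuous gc g1 (@cts_fun _ _ s)).

Lemma cone_simplex_face0 k (s : singular_simplex R X k) :
  (cone_simplex s \o face R ord0 : continuousType _ _) = s.
Proof.
apply/continuousEP => t.
change (cone_fun g x0 s (face_fun ord0 t) = s t).
have t0 : val (face_fun ord0 t) ord0 ord0 = 0 by rewrite /= face_vecE eqxx.
rewrite /cone_fun t0 eq_sym oner_eq0 g0; congr (s _); apply: simplex_eq => j.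
rewrite cone_projE t0 ?subr0 ?divr1 ?(eq_sym 0) ?oner_eq0//=.
rewrite face_vecE -val_eqE /= /unbump; congr (sval t _ _); apply/val_inj => /=.
by rewrite /bump inordK; have := ltn_ord j; lia.
Qed.

Lemma cone_simplex_faceS k (s : singular_simplex R X k.+1) (i : 'I_k.+2) :
  (cone_simplex s \o face R (fintype.lift ord0 i) : continuousType _ _) =
  cone_simplex (s \o face R i : continuousType _ _).
Proof.
apply/continuousEP => t.
change (cone_fun g x0 s (face_fun (fintype.lift ord0 i) t) =
        cone_fun g x0 (s \o face R i) t).
have t0 : val (face_fun (fintype.lift ord0 i) t) ord0 ord0 = val t ord0 ord0.
  rewrite /= face_vecE -val_eqE /= /unbump; congr (sval t _ _).
  by apply/val_inj; rewrite /= inordK.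
rewrite /cone_fun t0; case: ifPn => // t1; congr (g (s _, _)).
apply: simplex_eq => j; rewrite cone_projE t0//.
change (val (face_fun (fintype.lift ord0 i) t) ord0 (fintype.lift ord0 j) /
    (1 - val t ord0 ord0) = face_vec i (val (cone_proj t)) ord0 j).
rewrite [val (face_fun _ _)]/= !face_vecE (inj_eq lift_inj).
case: eqP => [|/eqP ij]; first by rewrite mul0r.
rewrite cone_projE//; congr (sval t _ _ / _).
have := ltn_ord j; have := ltn_ord i; move: ij; rewrite -val_eqE /= => ij li lj.
by apply/val_inj; rewrite /= /unbump /= /bump /= !inordK; lia.
Qed.

Definition cone_point : singular_simplex R X 0 :=
  mkcts (@cst_continuous (Simplex 0) X x0).

Lemma cone_simplex_face1 (s : singular_simplex R X 0) :
  (cone_simplex s \o face R (fintype.lift ord0 ord0) : continuousType _ _) =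
  cone_point.
Proof.
apply/continuousEP => t.
change (cone_fun g x0 s (face_fun (fintype.lift ord0 ord0) t) = x0).
have t0 : val (face_fun (fintype.lift ord0 ord0) t) ord0 ord0 = 1.
  rewrite /= face_vecE -val_eqE /= -(simplex_sum t) big_ord1.
  by congr (sval t _ _); apply/val_inj; rewrite /= inordK.
by rewrite /cone_fun t0 eqxx.
Qed.

Definition cone_chain k : {linear C k -> C k.+1} :=
  fglift (fun s : singular_simplex R X k => << cone_simplex s >> : C k.+1).

(** Face 0 of a cone is its base; every other face is the cone over a face of the base, with index
    and hence sign shifted by one. *)
Lemma boundary_cone k (c : C k.+1) :
  boundary R F X k.+2 (cone_chain k.+1 c) =
  c - cone_chain k (boundary R F X k.+1 c).
Proof.
suff : boundary R F X k.+2 (cone_chain k.+1 c) +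
  cone_chain k (boundary R F X k.+1 c) = c by move=> {2}<-; rewrite addrK.
move: c; apply: (@eq_chain R F X k.+1 _ ((boundary R F X k.+2 \o cone_chain k.+1) \+
  (cone_chain k \o boundary R F X k.+1)) idfun) => s /=.
rewrite [cone_chain k.+1 _]fgliftU !boundary_simplex big_ord_recl expr0 scale1r.
rewrite cone_simplex_face0 linear_sum /= -addrA -big_split big1 /= ?addr0// => i _.
rewrite linearZ /= [cone_chain k _]fgliftU cone_simplex_faceS.
by rewrite /bump /= exprS mulN1r scaleNr addNr.
Qed.

Definition augmentation (Y : topologicalType) : {linear chain R F Y 0 -> F^o} :=
  fglift (fun=> 1 : F^o).

(** Over a point, the second face of the cone is the cone point instead of a cone over a face,
    whence the augmentation term. *)
Lemma boundary_cone0 (c : C 0) :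
  boundary R F X 1 (cone_chain 0 c) = c - augmentation X c *: << cone_point >>.
Proof.
suff : boundary R F X 1 (cone_chain 0 c) +
  augmentation X c *: << cone_point >> = c by move=> {2}<-; rewrite addrK.
elim/freeg_ind_dom0: c => [|a s D _ _ IH].
  by rewrite !linear0 scale0r addr0.
rewrite !linearD scalerDl addrACA IH freegUZ !linearZ /= -scalerA -scalerDr.
congr (_ *: _ + _).
rewrite [cone_chain 0 _]fgliftU [augmentation _ _]fgliftU boundary_simplex.
rewrite !big_ord_recl big_ord0 expr0 scale1r cone_simplex_face0.
by rewrite cone_simplex_face1 addr0 expr1 scaleN1r scale1r subrK.
Qed.

Lemma cone_acyclic k (c : C k.+1) : boundary R F X k.+1 c = 0 ->
  boundary R F X k.+2 (cone_chain k.+1 c) = c.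
Proof. by move=> c0; rewrite boundary_cone c0 linear0 subr0. Qed.

End ConeChain.

Section Augmentation.
Variables (R : realType) (F : fieldType).

Lemma augmentation_boundary (X : topologicalType) (c : chain R F X 1) :
  augmentation R F X (boundary R F X 1 c) = 0.
Proof.
move: c; apply: (@eq_chain R F X 1 _ (augmentation R F X \o boundary R F X 1) \0).
move=> s /=; rewrite boundary_simplex linear_sum /= !big_ord_recl big_ord0 addr0.
rewrite !linearZ /= !fgliftU expr0 expr1.
by rewrite scale1r scaleN1r subrr.
Qed.

Lemma augmentation_chain_map (X Y : topologicalType) (f : continuousType X Y)
    (c : chain R F X 0) :
  augmentation R F Y (chain_map R F f 0 c) = augmentation R F X c.
Proof.
move: c; apply: (@eq_chain R F X 0 _ (augmentation R F Y \o chain_map R F f 0) _).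
by move=> s /=; rewrite chain_map_simplex !fgliftU.
Qed.

End Augmentation.

Section SimplexContraction.
Variables (R : realType) (k : nat).
Local Notation Simplex k := (@simplex R k).

(** Homotopies and contractions are parametrised by the whole line instead of the unit interval;
    truncating the time keeps the convex combination below inside the simplex. *)
Definition clamp (u : R) : R := Num.max 0 (Num.min 1 u).

Lemma clamp_continuous : continuous clamp.
Proof.
move=> u; apply: (@continuous_max R R (fun=> 0) (fun v => Num.min 1 v)).
  exact: cst_continuous.
apply: (@continuous_min R R (fun=> 1) id); first exact: cst_continuous.
exact: cvg_id.
Qed.

Lemma clamp_ge0 u : 0 <= clamp u.
Proof. by rewrite /clamp le_max lexx. Qed.

Lemma clamp_le1 u : clamp u <= 1.
Proof. by rewrite /clamp ge_max ler01 ge_min lexx. Qed.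

Lemma clamp0 : clamp 0 = 0.
Proof. by rewrite /clamp min_r ?ler01// maxxx. Qed.

Lemma clamp1 : clamp 1 = 1.
Proof. by rewrite /clamp minxx max_r ?ler01. Qed.

Lemma simplex_contraction_subproof (p : Simplex k * R) :
  (1 - clamp p.2) *: val p.1 + clamp p.2 *: delta_mx 0 0 \in Simplex k.
Proof.
rewrite inE; split => [j|].
  rewrite !mxE addr_ge0// mulr_ge0 ?subr_ge0 ?clamp_le1 ?clamp_ge0//.
  exact: simplex_ge0.
under eq_bigr do rewrite !mxE; rewrite big_split /= -!mulr_sumr simplex_sum.
rewrite (bigD1 ord0)//= big1 ?addr0 ?mulr1 ?subrK// => j /negbTE ->; by rewrite mulr0n.
Qed.

Definition simplex_contraction (p : Simplex k * R) : Simplex k :=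
  exist _ ((1 - clamp p.2) *: val p.1 + clamp p.2 *: delta_mx 0 0)
    (simplex_contraction_subproof p).

Lemma simplex_contraction_continuous : continuous simplex_contraction.
Proof.
apply: continuous_comp_initial; apply: mx_continuous => i j.
rewrite (ord1 i) (_ : (fun _ => _) = (fun p : Simplex k * R =>
    (1 - clamp p.2) * val p.1 ord0 j + clamp p.2 * (delta_mx 0 0 : 'rV_k.+1) ord0 j)).
  have cc : continuous (fun p : Simplex k * R => clamp p.2).
    apply: continuous_compose; [exact: clamp_continuous|exact: continuous_snd].
  apply: cont_add; apply: cont_mul => //; [|  |exact: cont_cst].
    by apply: cont_sub => //; exact: cont_cst.
  by apply: (continuous_compose (@simplex_coord_continuous R k j));
    exact: continuous_fst.
by apply/funext => p; rewrite /= set_valE /= !mxE.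
Qed.

Lemma simplex_contraction0 t : simplex_contraction (t, 0) = t.
Proof.
by apply: val_inj; rewrite /= clamp0 subr0 scale1r scale0r addr0.
Qed.

Lemma simplex_contraction1 t : simplex_contraction (t, 1) = vertex R ord0.
Proof. by apply: val_inj; rewrite /= clamp1 subrr scale1r scale0r add0r. Qed.

End SimplexContraction.

Section Cylinder.
Variable R : realType.

Lemma cylinder_end_continuous (X : topologicalType) (r : R) :
  continuous (fun x : X => (x, r)).
Proof. by apply: continuous_pair => x; [exact: cvg_id|exact: cvg_cst]. Qed.

Definition cylinder_end (X : topologicalType) (r : R) : continuousType X (X * R)%type :=
  mkcts (@cylinder_end_continuous X r).

Lemma cylinder_map_continuous (X Y : topologicalType) (f : continuousType X Y) :
  continuous (fun p : X * R => (f p.1, p.2)).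
Proof.
apply: continuous_pair; last exact: continuous_snd.
by apply: (continuous_compose (@cts_fun _ _ f)); exact: continuous_fst.
Qed.

Definition cylinder_map (X Y : topologicalType) (f : continuousType X Y) :
  continuousType (X * R)%type (Y * R)%type := mkcts (@cylinder_map_continuous X Y f).

Variable k : nat.
Local Notation Cyl := (@simplex R k * R)%type.

Definition cylinder_contraction (p : Cyl * R) : Cyl :=
  (simplex_contraction (p.1.1, p.2), (1 - p.2) * p.1.2).

Lemma cylinder_contraction_continuous : continuous cylinder_contraction.
Proof.
apply: continuous_pair.
  apply: (continuous_compose (@simplex_contraction_continuous R k)).
  apply: continuous_pair; last exact: continuous_snd.
  by apply: continuous_compose; exact: continuous_fst.
apply: cont_mul.
  by apply: cont_sub; [exact: cont_cst|exact: continuous_snd].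
by apply: continuous_compose; [exact: continuous_snd|exact: continuous_fst].
Qed.

Lemma cylinder_contraction0 x : cylinder_contraction (x, 0) = x.
Proof.
by case: x => t r; rewrite /cylinder_contraction /= simplex_contraction0 subr0 mul1r.
Qed.

Lemma cylinder_contraction1 x : cylinder_contraction (x, 1) = (vertex R ord0, 0).
Proof.
by case: x => t r; rewrite /cylinder_contraction /= simplex_contraction1 subrr mul0r.
Qed.

End Cylinder.

(** * Homotopy invariance of singular homology *)

Section Homotopy.
Variables (R : realType) (F : fieldType).
Local Notation Simplex k := (@simplex R k).
Local Notation C X k := (chain R F X k).
Local Notation d X k := (boundary R F X k).
Local Notation "f _# k" := (chain_map R F f k) (at level 2, format "f _# k").

Let cylinder_cone k j :
    {linear C (Simplex k * R)%type j -> C (Simplex k * R)%type j.+1} :=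
  cone_chain F (@cylinder_contraction_continuous R k) (@cylinder_contraction1 R k) j.

Let ends k : C (Simplex k * R)%type k :=
  << (cylinder_end (Simplex k) 1 : singular_simplex R _ k) >> -
  << (cylinder_end (Simplex k) 0 : singular_simplex R _ k) >>.

(* Acyclic models: a chain of the cylinder over the standard simplex whose
   boundary is the top minus the bottom minus the sides. *)
Fixpoint prism_model (k : nat) : C (Simplex k * R)%type k.+1 :=
  match k return C (Simplex k * R)%type k.+1 with
  | 0 => cylinder_cone 0 0 (ends 0)
  | k'.+1 => cylinder_cone k'.+1 k'.+1 (ends k'.+1 -
      fglift (fun s : singular_simplex R (Simplex k'.+1) k' =>
                (cylinder_map R s) _# k'.+1 (prism_model k'))
        (d (Simplex k'.+1) k'.+1 << (idfun : singular_simplex R _ k'.+1) >>))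
  end.

(** Extension of the models to all chains by naturality. The chain subtracted from the ends in
    [prism_model] is this map, one degree lower, applied to the boundary of the identity simplex. *)
Definition prism X k : {linear C X k -> C (X * R)%type k.+1} :=
  fglift (fun s : singular_simplex R X k =>
            (cylinder_map R s) _# k.+1 (prism_model k)).

Lemma cylinder_map_ends X k (s : singular_simplex R X k) :
  (cylinder_map R s) _# k (ends k) =
  (cylinder_end X 1) _# k << s >> - (cylinder_end X 0) _# k << s >>.
Proof.
rewrite linearB /= !chain_map_simplex.
by congr (<< _ >> - << _ >>); apply/continuousEP.
Qed.

Lemma prism_chain_map (X Y : topologicalType) (f : continuousType X Y) k c :
  (cylinder_map R f) _# k.+1 (prism X k c) = prism Y k (f _# k c).
Proof.
move: c; apply: (@eq_chain R F X k _
  ((cylinder_map R f) _# k.+1 \o prism X k) (prism Y k \o f _# k)) => s /=.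
rewrite chain_map_simplex ![prism _ _ _]fgliftU chain_map_comp.
by congr (chain_map R F _ _ _); apply/continuousEP.
Qed.

(** On cycles the term coming from the sides disappears, so that one formula covers all degrees. The
    induction hypothesis is applied only to the boundary of the identity simplex, which is a
    cycle. *)
Lemma prism_boundary (X : topologicalType) k (c : C X k) : d X k c = 0 ->
  d (X * R)%type k.+1 (prism X k c) =
  (cylinder_end X 1) _# k c - (cylinder_end X 0) _# k c.
Proof.
elim: k X c => [|k IH] X c.
  move=> _; move: c; apply: (@eq_chain R F X 0 _ (d (X * R)%type 1 \o prism X 0)
    ((cylinder_end X 1) _# 0 \- (cylinder_end X 0) _# 0)) => s.
  change (d (X * R)%type 1 (prism X 0 << s >>) =
    (cylinder_end X 1) _# 0 << s >> - (cylinder_end X 0) _# 0 << s >>).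
  rewrite [prism _ _ _]fgliftU -(@chain_map_boundary _ _ _ _ _ 1) /= /cylinder_cone boundary_cone0; last first.
    exact: cylinder_contraction0.
  (* The two ends have augmentations that cancel, so their difference is the boundary of its
     cone. *)
  have -> : augmentation R F (Simplex 0 * R)%type (ends 0) = 0.
    by rewrite linearB /= ![augmentation _ _ _ _]fgliftU subrr.
  by rewrite scale0r subr0 cylinder_map_ends.
move=> dc; pose iota := << (idfun : singular_simplex R (Simplex k.+1) k.+1) >> : C _ _.
have dmodel : d (Simplex k.+1 * R)%type k.+2 (prism_model k.+1) =
    ends k.+1 - prism (Simplex k.+1) k (d (Simplex k.+1) k.+1 iota).
  rewrite /= /cylinder_cone cone_acyclic//; first exact: cylinder_contraction0.
  have -> : ends k.+1 = (cylinder_end _ 1) _# k.+1 iota - (cylinder_end _ 0) _# k.+1 iota.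
    by rewrite !chain_map_simplex; congr (<< _ >> - << _ >>); apply/continuousEP.
  rewrite linearB /= -/(prism _ _) IH ?boundary_boundary// linearB /=.
  by rewrite !(@chain_map_boundary _ _ _ _ _ k.+1) subrr.
(* A single simplex is not a cycle: a check on generators requires the formula that keeps the
   sides. *)
suff -> : d (X * R)%type k.+2 (prism X k.+1 c) =
    (cylinder_end X 1) _# k.+1 c - (cylinder_end X 0) _# k.+1 c -
    prism X k (d X k.+1 c) by rewrite dc linear0 subr0.
move: c {dc}; apply: (@eq_chain R F X k.+1 _ (d (X * R)%type k.+2 \o prism X k.+1)
  (((cylinder_end X 1) _# k.+1 \- (cylinder_end X 0) _# k.+1) \- (prism X k \o d X k.+1))).
move=> s.
change (d (X * R)%type k.+2 (prism X k.+1 << s >>) =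
  (cylinder_end X 1) _# k.+1 << s >> - (cylinder_end X 0) _# k.+1 << s >> -
  prism X k (d X k.+1 << s >>)); rewrite [prism _ k.+1 _]fgliftU -(@chain_map_boundary _ _ _ _ _ k.+2) dmodel linearB.
rewrite cylinder_map_ends prism_chain_map (@chain_map_boundary _ _ _ _ _ k.+1).
suff -> : s _# k.+1 iota = << s >> by [].
by rewrite chain_map_simplex; congr << _ >>; apply/continuousEP.
Qed.

Lemma homotopic_homology_map (X Y : topologicalType) (f g : continuousType X Y)
    (H : X * R -> Y) : continuous H -> (forall x, H (x, 1) = f x) ->
  (forall x, H (x, 0) = g x) ->
  forall k, singular_homology_map R F f k =1 singular_homology_map R F g k.
Proof.
move=> Hc H1 H0 k h; rewrite -(homology_class_repr h).
move: (repr h) => z /=.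
rewrite !(homology_map_class (@chain_map_boundary _ _ _ _ _ k.+1)).
apply/eqP/homology_classP.
exists ((mkcts Hc : continuousType _ _) _# k.+1 (prism X k (val z))).
rewrite -(@chain_map_boundary _ _ _ _ _ k.+1) prism_boundary; last exact: (eqP (cycleP z)).
rewrite linearB !chain_map_comp.
transitivity (f _# k (val z) - g _# k (val z)); last by [].
have -> : (mkcts Hc \o cylinder_end X 1 : continuousType _ _) = f.
  by apply/continuousEP => x; exact: H1.
have -> // : (mkcts Hc \o cylinder_end X 0 : continuousType _ _) = g.
by apply/continuousEP => x; exact: H0.
Qed.

End Homotopy.

(** * The homology of the circle *)

Section Circle.
Variable R : realType.

Definition circle : set (R * R) := [set p | p.1 ^+ 2 + p.2 ^+ 2 = 1].

Lemma circle_exp_subproof (x : R) : (cos x, sin x) \in circle.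
Proof. by rewrite inE /circle /= cos2Dsin2. Qed.

Definition circle_exp_fun (x : R) : circle :=
  exist _ (cos x, sin x) (circle_exp_subproof x).

Lemma circle_exp_continuous : continuous circle_exp_fun.
Proof.
apply: continuous_comp_initial; apply: continuous_pair.
  exact: continuous_cos.
exact: continuous_sin.
Qed.

Definition circle_exp : continuousType R circle := mkcts circle_exp_continuous.

Lemma circle_eq (p q : circle) : (val p).1 = (val q).1 -> (val p).2 = (val q).2 ->
  p = q.
Proof.
by move=> pq1 pq2; apply/val_inj; case: (val p) (val q) pq1 pq2 => ? ? [? ?] /= -> ->.
Qed.

Lemma cos_sin_surj (c s : R) : c ^+ 2 + s ^+ 2 = 1 ->
  exists x, cos x = c /\ sin x = s.
Proof.
move=> cs; have c1 : -1 <= c <= 1 by nra.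
have s2 : 1 - c ^+ 2 = s ^+ 2 by rewrite -cs addrAC subrr add0r.
have [s0|s0] := leP 0 s.
  exists (acos c); rewrite acosK ?in_itv//= sin_acos// s2 sqrtr_sqr ger0_norm//.
exists (- acos c); rewrite cosN sinN acosK ?in_itv//= sin_acos// s2 sqrtr_sqr.
by rewrite ltr0_norm// opprK.
Qed.

Lemma cos_eq1 (x : R) : cos x = 1 -> exists m : int, x = (pi *+ 2) *~ m.
Proof.
move=> x1; pose T : R := pi *+ 2.
have T0 : 0 < T by rewrite mulrn_wgt0// pi_gt0.
pose m := Num.floor (x / T); exists m; rewrite -/T.
have /andP[mx xm] : T *~ m <= x < T *~ m + T.
  rewrite -mulrzr -{3}[T]mulr1 -mulrDr -ler_pdivlMl// -ltr_pdivrMl//.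
  by rewrite mulrC floor_le_tmp -intrD1 floorD1_gt.
pose r := x - T *~ m.
have r1 : cos r = 1.
  by rewrite /r -mulrNz (periodicz (@cosD2pi R)).
suff : r = 0 by move/eqP; rewrite subr_eq0 => /eqP.
have r0 : 0 <= r by rewrite subr_ge0.
have rT : r < T by rewrite ltrBlDl.
(* The cosine is injective on [[0, pi]]; beyond [pi], the point [T - r] is compared with 0 instead
   of [r]. *)
have [rpi|rpi] := leP r pi.
  by apply: cos_inj; rewrite ?in_itv/= ?r0 ?rpi ?lexx ?pi_ge0// cos0.
have : T - r = 0.
  apply: cos_inj; rewrite ?in_itv/= ?lexx ?pi_ge0//.
    by rewrite subr_ge0 ltW//= lerBlDr /T mulr2n lerD2l ltW.
  by rewrite cos0 addrC cosD2pi cosN.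
by move/eqP; rewrite subr_eq0 => /eqP Tr; rewrite Tr ltxx in rT.
Qed.

Lemma circle_exp_eq (x y : R) : circle_exp x = circle_exp y ->
  exists m : int, x - y = (pi *+ 2) *~ m.
Proof.
move=> xy; apply: cos_eq1; rewrite cosB.
have -> : cos x = cos y by have := congr1 (fun p : circle => (val p).1) xy.
have -> : sin x = sin y by have := congr1 (fun p : circle => (val p).2) xy.
by rewrite -!expr2 cos2Dsin2.
Qed.

Lemma circle_exp_shift (x : R) : circle_exp (x + pi *+ 2) = circle_exp x.
Proof. by apply: circle_eq; [exact: cosD2pi|exact: sinD2pi]. Qed.

Lemma cos_sin_atan (u v : R) : 0 < u -> u ^+ 2 + v ^+ 2 = 1 ->
  cos (atan (v / u)) = u /\ sin (atan (v / u)) = v.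
Proof.
move=> u0 uv; have cu : cos (atan (v / u)) = u.
  rewrite cos_atan -[RHS]invrK; congr (_^-1).
  rewrite (_ : 1 + _ = u^-1 ^+ 2); last first.
    have un := expf_neq0 2 (lt0r_neq0 u0).
    rewrite expr_div_n exprVn; apply: (mulIf un).
    by rewrite mulrDl mul1r divfK// mulVf.
  by rewrite sqrtr_sqr ger0_norm// invr_ge0 ltW.
split=> //; have := atanK (v / u); rewrite /tan cu.
by move/(divIf (lt0r_neq0 u0)).
Qed.

(** * Lifting maps from a contractible space along the covering of the circle by the line *)

Section Lift.
Variables (X : topologicalType) (g : X * R -> X) (x0 : X).
Hypotheses (gc : continuous g) (g0 : forall x, g (x, 0) = x).
Hypothesis (g1 : forall x, g (x, 1) = x0).

Lemma int_valued_eq (f : R -> R) : continuous f ->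
  (forall t, exists m : int, f t = m%:~R) -> f 0 = f 1.
Proof.
move=> fc fZ; have [m0 f0] := fZ 0; have [m1 f1] := fZ 1.
have half (m l : int) : m%:~R + 2^-1 <> l%:~R :> R.
  move=> ml; have : (m * 2 + 1)%:~R = (l * 2)%:~R :> R.
    by rewrite intrD !intrM -ml; have -> : 2%:~R = 2 :> R by []; lra.
  by move/intr_inj; lia.
apply: contrapT => f01.
(* The half-integer just above the smaller of the two end values: it lies between them, so it would
   be attained, which [half] excludes. *)
pose v := Num.min (f 0) (f 1) + 2^-1.
have [|c _ fcv] := @IVT R f 0 1 v ler01 (continuous_subspaceT fc).
  have m01 : m0 != m1 by apply/eqP => mm; apply: f01; rewrite f0 f1 mm.
  rewrite /v f0 f1; have [le01|lt10] := leP (m0%:~R : R) m1%:~R.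
    have : (m0 + 1)%:~R <= m1%:~R :> R.
      by rewrite ler_int; move: le01 m01; rewrite ler_int; lia.
    by rewrite intrD; lra.
  have : (m1 + 1)%:~R <= m0%:~R :> R.
    by rewrite ler_int; move: lt10; rewrite ltr_int; lia.
  by rewrite intrD; lra.
have [l] := fZ c; rewrite fcv /v f0 f1.
by case: (leP (m0%:~R : R)) => _; exact: half.
Qed.

(** The contraction joins [x] to [x0]; along this path the difference of the lifts divided by 2 pi
    is continuous and integer valued, hence has the same value at both ends. *)
Lemma circle_lift_unique (h h' : X -> R) : continuous h -> continuous h' ->
  (forall x, circle_exp (h x) = circle_exp (h' x)) ->
  exists m : int, forall x, h x - h' x = (pi *+ 2) *~ m.
Proof.
move=> hc hc' hh'; have [m hm] := circle_exp_eq (hh' x0); exists m => x.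
have T0 : (pi *+ 2 : R) != 0 by rewrite mulrn_eq0 /= lt0r_neq0// pi_gt0.
rewrite -hm -(g1 x) -{1 2}(g0 x).
have hgc (k : X -> R) : continuous k -> continuous (fun t : R => k (g (x, t))).
  move=> kc; apply: (continuous_compose kc); apply: (continuous_compose gc).
  by apply: continuous_pair => t; [exact: cvg_cst|exact: cvg_id].
apply: (mulIf (invr_neq0 T0)).
apply: (@int_valued_eq (fun t => (h (g (x, t)) - h' (g (x, t))) / (pi *+ 2))).
  by apply: cont_mul; [apply: cont_sub; exact: hgc|exact: cont_cst].
move=> t; have [l ->] := circle_exp_eq (hh' (g (x, t))); exists l.
by rewrite -mulrzr mulrAC mulfV// mul1r.
Qed.

(* By compactness the contraction can be cut into N.+1 steps along which f turns
   by less than pi / 2; the lift adds up these angles. *)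
Lemma circle_lift (f : X -> circle) : compact [set: X] -> continuous f ->
  exists2 h : X -> R, continuous h & forall x, circle_exp (h x) = f x.
Proof.
move=> cX fc.
pose c x := (val (f x)).1; pose s x := (val (f x)).2.
have cs x : c x ^+ 2 + s x ^+ 2 = 1 := set_valP (f x).
have vc : continuous (fun x => val (f x)).
  by apply: continuous_compose fc; exact: initial_continuous.
have cc : continuous c by apply: continuous_compose vc; exact: continuous_fst.
have sc : continuous s by apply: continuous_compose vc; exact: continuous_snd.
(* [dot] and [cross] are the cosine and the sine of the angle from [f x] to [f y]. *)
pose dot x y := c x * c y + s x * s y.
pose cross x y := c x * s y - s x * c y.
have dot_cross x y : dot x y ^+ 2 + cross x y ^+ 2 = 1.
  transitivity ((c x ^+ 2 + s x ^+ 2) * (c y ^+ 2 + s y ^+ 2)).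
    by rewrite /dot /cross; ring.
  by rewrite !cs mulr1.
have [N HN] : exists N : nat, forall x (t : R), 0 <= t <= 1 ->
    0 < dot (g (x, t)) (g (x, t - N.+1%:R^-1)).
  have cK : compact ([set: X] `*` (`[0, 1]%classic : set R)).
    by apply: compact_setX => //; exact: segment_compact.
  (* At [e = 0] the value of [dot] is 1; compactness makes its positivity uniform for small [e], and
     the step length is then taken from the sequence [1 / N.+1]. *)
  have De : \forall e \near (0 : R), [set: X] `*` (`[0, 1]%classic : set R) `<=`
      (fun y : X * R => 0 < dot (g y) (g (y.1, y.2 - e))).
    apply: ((compact_near_coveringP _).1 cK R (nbhs (0 : R))
      (fun e y => 0 < dot (g y) (g (y.1, y.2 - e)))) => y _.
    have c1 : continuous (fun p : (X * R) * R => g p.1).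
      by apply: continuous_compose; [exact: gc|exact: continuous_fst].
    have c2 : continuous (fun p : (X * R) * R => g (p.1.1, p.1.2 - p.2)).
      apply: (continuous_compose gc); apply: continuous_pair.
        by apply: continuous_compose; exact: continuous_fst.
      apply: cont_sub; last exact: continuous_snd.
      by apply: continuous_compose; [exact: continuous_snd|exact: continuous_fst].
    have dc : continuous (fun p : (X * R) * R => dot (g p.1) (g (p.1.1, p.1.2 - p.2))).
      apply: cont_add; apply: cont_mul; apply: continuous_compose; eassumption.
    apply: (dc (y, 0) [set x | 0 < x]); apply: open_nbhs_nbhs; split.
      exact: open_gt.
    by rewrite /= subr0 -surjective_pairing /dot -!expr2 cs ltr01.
  have [N _ HN] := @cvg_harmonic R _ De.
  by exists N => x t t01; exact: (HN N (leqnn N) (x, t)).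
(* [y 0 x] is [x0] and [y N.+1 x] is [x]: the contraction is run backwards, so that the sum of
   angles starts from a constant, an angle [al] of [f x0]. *)
pose e : R := N.+1%:R^-1; pose y j x := g (x, 1 - j%:R * e).
have yc j : continuous (y j).
  apply: (continuous_compose gc); apply: continuous_pair => x; first exact: cvg_id.
  exact: cvg_cst.
have N0 : 0 < N.+1%:R :> R by rewrite ltr0n.
have dotp j x : (j < N.+1)%N -> 0 < dot (y j x) (y j.+1 x).
  move=> jN; have -> : y j.+1 x = g (x, 1 - j%:R * e - e).
    by rewrite /y; congr (g (_, _)); rewrite -natr1 mulrDl mul1r opprD addrA.
  apply: HN; rewrite subr_ge0 lerBlDr lerDl mulr_ge0 ?ler0n ?invr_ge0 ?ler0n// andbT.
  by rewrite ler_pdivrMr// mul1r ler_nat ltnW.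
pose delta j x := atan (cross (y j x) (y j.+1 x) / dot (y j x) (y j.+1 x)).
have [al [cal sal]] := cos_sin_surj (cs x0).
pose h j x := al + \sum_(i < j) delta i x.
have hE j x : (j <= N.+1)%N -> cos (h j x) = c (y j x) /\ sin (h j x) = s (y j x).
  elim: j => [_|j IH jN].
    by rewrite /h big_ord0 addr0 /y mul0r subr0 g1.
  have [ch sh] := IH (ltnW jN).
  have -> : h j.+1 x = h j x + delta j x by rewrite /h big_ord_recr addrA.
  have [cd sd] := cos_sin_atan (dotp j x jN) (dot_cross _ _).
  rewrite cosD sinD ch sh cd sd /dot /cross; split.
    transitivity ((c (y j x) ^+ 2 + s (y j x) ^+ 2) * c (y j.+1 x)); first ring.
    by rewrite cs mul1r.
  transitivity ((c (y j x) ^+ 2 + s (y j x) ^+ 2) * s (y j.+1 x)); first ring.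
  by rewrite cs mul1r.
exists (h N.+1) => [|x]; last first.
  have [ch sh] := hE N.+1 x (leqnn _).
  have yN : y N.+1 x = x by rewrite /y mulfV ?lt0r_neq0// subrr g0.
  by apply: circle_eq; rewrite /= ?ch ?sh yN.
apply: cont_add; first exact: cont_cst.
apply: cont_sum => j x; apply: (@continuous_comp _ _ _
  (fun x => cross (y j x) (y j.+1 x) / dot (y j x) (y j.+1 x)) (@atan R)).
  apply: continuous_at_div; first by rewrite lt0r_neq0// dotp.
    by apply: cont_sub; apply: cont_mul; apply: continuous_compose => //; exact: yc.
  by apply: cont_add; apply: cont_mul; apply: continuous_compose => //; exact: yc.
exact: continuous_atan.
Qed.

End Lift.
End Circle.

(** * The exact sequence of the covering and its consequences *)

Section CircleHomology.
Variables (R : realType) (F : fieldType).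
Local Notation Simplex k := (@simplex R k).
Local Notation C X k := (chain R F X k).
Local Notation d X k := (boundary R F X k).
Local Notation S1 := (@circle R).
Local Notation "f _# k" := (chain_map R F f k) (at level 2, format "f _# k").
Local Notation p := (circle_exp R).

Lemma line_contraction_continuous : continuous (fun q : R * R => (1 - q.2) * q.1).
Proof.
apply: cont_mul; last exact: continuous_fst.
by apply: cont_sub; [exact: cont_cst|exact: continuous_snd].
Qed.

Lemma line_contraction0 (x : R) : (1 - (x, 0 : R).2) * (x, 0 : R).1 = x.
Proof. by rewrite subr0 mul1r. Qed.

Lemma line_contraction1 (x : R) : (1 - (x, 1 : R).2) * (x, 1 : R).1 = 0.
Proof. by rewrite subrr mul0r. Qed.

Let K k : {linear C R k -> C R k.+1} :=
  cone_chain F line_contraction_continuous line_contraction1 k.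

Definition line_point : singular_simplex R R 0 := @cone_point R R 0.

Lemma line_acyclic k (c : C R k.+1) : d R k.+1 c = 0 -> exists c', d R k.+2 c' = c.
Proof.
move=> dc; exists (K k.+1 c).
by apply: cone_acyclic => //; exact: line_contraction0.
Qed.

Lemma line_boundary0 (c : C R 0) :
  exists c', d R 1 c' = c - augmentation R F R c *: << line_point >>.
Proof. by exists (K 0 c); apply: boundary_cone0; exact: line_contraction0. Qed.

Lemma shift_continuous (a : R) : continuous (fun x : R => x + a).
Proof. by apply: cont_add => x; [exact: cvg_id|exact: cvg_cst]. Qed.

Definition shift (a : R) : continuousType R R := mkcts (@shift_continuous a).
Local Notation tau := (shift (pi *+ 2)).

Lemma circle_exp_tau k (c : C R k) : p _# k (tau _# k c) = p _# k c.
Proof.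
rewrite chain_map_comp; congr (chain_map _ _ _ _ _); apply/continuousEP => x.
exact: circle_exp_shift.
Qed.

Lemma lift_simplex k (s : singular_simplex R S1 k) :
  exists s' : singular_simplex R R k, (p \o s' : continuousType _ _) = s.
Proof.
have [h hc ph] := circle_lift (@simplex_contraction_continuous R k)
  (@simplex_contraction0 R k) (@simplex_contraction1 R k) (@compact_simplex R k)
  (@cts_fun _ _ s).
by exists (mkcts hc); apply/continuousEP.
Qed.

Definition chosen_lift k (s : singular_simplex R S1 k) : singular_simplex R R k :=
  projT1 (cid (lift_simplex s)).

Lemma chosen_liftK k (s : singular_simplex R S1 k) :
  (p \o chosen_lift s : continuousType _ _) = s.
Proof. by rewrite /chosen_lift; case: cid. Qed.

(** A linear section of the projection on chains. The lifts of a simplex and of its faces are chosen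
    independently, so it need not commute with boundaries; the defect lies in the image of
    [1 - tau]. *)
Definition lift_chain k : {linear C S1 k -> C R k} :=
  fglift (fun s : singular_simplex R S1 k => << chosen_lift s >> : C R k).

Lemma lift_chainK k (c : C S1 k) : p _# k (lift_chain k c) = c.
Proof.
move: c; apply: (@eq_chain R F S1 k _ (p _# k \o lift_chain k) idfun) => s.
change (p _# k (lift_chain k << s >>) = << s >>).
by rewrite [lift_chain _ _]fgliftU chain_map_simplex chosen_liftK.
Qed.

(** Telescoping: [tau^n - 1] factors through [1 - tau]. *)
Lemma shift_simplex_coboundary k (s u : singular_simplex R R k) (n : nat) :
  (forall t, s t = u t + (pi *+ 2) *+ n) ->
  exists y : C R k, << s >> - << u >> = y - tau _# k y.
Proof.
elim: n s => [|n IH] s su.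
  exists 0; rewrite linear0 subr0; suff -> : s = u by rewrite subrr.
  by apply/continuousEP => t; rewrite su addr0.
pose s' : singular_simplex R R k := (shift (- (pi *+ 2)) \o s : continuousType _ _).
have [|y ys] := IH s' => [t|].
  change (s t - pi *+ 2 = u t + pi *+ 2 *+ n).
  have -> : s t = u t + (pi *+ 2 *+ n + pi *+ 2) by rewrite su mulrSr.
  by rewrite addrA addrK.
have ts : tau _# k << s' >> = << s >>.
  rewrite chain_map_simplex; congr << _ >>; apply/continuousEP => t.
  by change (s t - pi *+ 2 + pi *+ 2 = s t); rewrite subrK.
exists (y - << s' >>); rewrite linearB ts.
transitivity ((y - tau _# k y) + (<< s >> - << s' >>)).
  by rewrite -ys [RHS]addrC addrA subrK.
by rewrite opprB [<< s >> - tau _# k y]addrC [RHS]addrACA [<< s >> - _]addrC.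
Qed.

(** Exactness in the middle. It is enough that [c] minus the chosen lift of its projection lies in
    the image of [1 - tau], which is a linear condition; on a generator, two lifts of one simplex
    differ by a constant multiple of 2 pi. *)
Lemma ker_circle_exp k (c : C R k) : p _# k c = 0 ->
  exists y, c = y - tau _# k y.
Proof.
move=> pc; suff [y yc] : exists y, c - lift_chain k (p _# k c) = y - tau _# k y.
  by exists y; rewrite -yc pc linear0 subr0.
elim/freeg_ind_dom0: c {pc} => [|a s D _ _ [y yD]].
  by exists 0; rewrite !linear0.
suff [z zs] : exists z, << s >> - lift_chain k (p _# k << s >>) = z - tau _# k z.
  exists (a *: z + y); rewrite freegUZ (linearP (p _# k)).
  rewrite (linearP (lift_chain k)) (linearP (tau _# k)) !opprD.
  by rewrite addrACA yD -scalerBr zs scalerBr addrACA.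
rewrite chain_map_simplex [lift_chain _ _]fgliftU.
set u := chosen_lift _.
have pus : (p \o u : continuousType _ _) = (p \o s : continuousType _ _).
  exact: chosen_liftK.
have [|m um] := @circle_lift_unique R _ _ _ (@simplex_contraction_continuous R k)
  (@simplex_contraction0 R k) (@simplex_contraction1 R k) s u
  (@cts_fun _ _ s) (@cts_fun _ _ u).
  by move=> x; have /continuousEP/(_ x) := pus.
(* The sign of [m] decides which of the two lifts is a forward translate of the other. *)
case: m um => m um.
  apply: (@shift_simplex_coboundary _ _ _ m) => t.
  by rewrite -[s t](subrK (u t)) um addrC.
have [t|w wus] := @shift_simplex_coboundary _ u s m.+1.
  by rewrite -[u t](subrK (s t)) -opprB um NegzE mulrNz opprK addrC.
by exists (- w); rewrite linearN -opprD -wus opprB.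
Qed.

Lemma coeff_tau k (y : C R k) (s : singular_simplex R R k) :
  coeff (tau \o s : continuousType _ _) (tau _# k y) = coeff s y.
Proof.
(* Both coefficients are read as linear forms in [y], so that generators suffice; there the claim is
   the injectivity of the translation. *)
move: y; apply: (@eq_chain R F R k _
  ((fglift (fun u : singular_simplex R R k =>
     (u == (tau \o s : continuousType _ _))%:R : F^o)) \o tau _# k)
  (fglift (fun u : singular_simplex R R k => (u == s)%:R : F^o))) => u.
change (coeff (tau \o s : continuousType _ _) (tau _# k << u >>) =
  coeff s (<< u >> : C R k)).
rewrite chain_map_simplex !coeffU; congr (_ * (nat_of_bool _)%:R); apply/eqP/eqP => [us|-> //].
apply/continuousEP => t; have /continuousEP/(_ t) := us.
exact: addIr.
Qed.

(* The support of a fixed chain is finite and stable under tau, which has no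
   finite orbit. *)
Lemma tau_fixed_eq0 k (y : C R k) : y - tau _# k y = 0 -> y = 0.
Proof.
move=> /eqP; rewrite subr_eq0 => /eqP yt; apply/eqP/freeg_eqP => s.
rewrite coeff0; apply/eqP/negPn/negP => s0.
pose sh n : singular_simplex R R k :=
  iter n (fun u : singular_simplex R R k => (tau \o u : continuousType _ _)) s.
have shE n t : sh n t = s t + (pi *+ 2) *+ n.
  elim: n => [|n IH]; first by rewrite addr0.
  change (sh n t + pi *+ 2 = s t + pi *+ 2 *+ n.+1).
  by rewrite IH -addrA -mulrSr.
have sh_dom n : sh n \in dom y.
  rewrite mem_dom; elim: n => [//|n].
  by have := coeff_tau y (sh n); rewrite -yt => <-.
have sh_inj : injective sh.
  move=> m n /continuousEP/(_ (vertex R ord0)); rewrite !shE => /addrI.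
  have T0 : 0 < pi *+ 2 :> R by rewrite mulrn_wgt0// pi_gt0.
  exact: mulrIn (lt0r_neq0 T0) _ _.
have := @uniq_leq_size _ [seq sh i | i <- iota 0 (size (dom y)).+1] (dom y).
have -> : size [seq sh i | i <- iota 0 (size (dom y)).+1] = (size (dom y)).+1.
  exact: etrans (size_map _ _) (size_iota _ _).
rewrite map_inj_uniq// iota_uniq ltnn => /(_ isT) H.
by suff : false by []; apply: H => u /mapP[i _ ->]; exact: sh_dom.
Qed.

(** The boundary of a lift of [c] is [(1 - tau) e], where [e] is a cycle because [1 - tau] is
    injective. As [e] has positive degree, it bounds some [g]; the lift minus [(1 - tau) g] is then
    a cycle of the line, hence a boundary, and still projects to [c]. *)
Lemma circle_acyclic k (c : C S1 k.+2) : d S1 k.+2 c = 0 ->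
  exists c', d S1 k.+3 c' = c.
Proof.
move=> dc; have pd : p _# k.+1 (d R k.+2 (lift_chain k.+2 c)) = 0.
  by rewrite (@chain_map_boundary _ _ _ _ _ k.+2) lift_chainK.
have [e de] := ker_circle_exp pd.
have /line_acyclic[g dg] : d R k.+1 e = 0.
  apply: tau_fixed_eq0; rewrite (@chain_map_boundary _ _ _ _ _ k.+1) -linearB -de.
  exact: boundary_boundary.
have /line_acyclic[h dh] : d R k.+2 (lift_chain k.+2 c - (g - tau _# k.+2 g)) = 0.
  rewrite linearB [d _ _ (g - _)]linearB -(@chain_map_boundary _ _ _ _ _ k.+2).
  by rewrite dg de subrr.
exists (p _# k.+3 h).
by rewrite -(@chain_map_boundary _ _ _ _ _ k.+3) dh linearB lift_chainK
  [p _# _ (g - _)]linearB circle_exp_tau subrr subr0.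
Qed.

Lemma path2pi_continuous :
  continuous (fun t : Simplex 1 => (pi *+ 2) * val t ord0 ord_max : R).
Proof. by apply: cont_mul; [exact: cont_cst|exact: simplex_coord_continuous]. Qed.

Definition path2pi : singular_simplex R R 1 := mkcts path2pi_continuous.

Definition circle_loop : singular_simplex R S1 1 := (p \o path2pi : continuousType _ _).

Lemma boundary_path2pi :
  d R 1 << path2pi >> = tau _# 0 << line_point >> - << line_point >>.
Proof.
rewrite boundary_simplex !big_ord_recl big_ord0 addr0 expr0 expr1 scale1r scaleN1r.
rewrite chain_map_simplex; congr (<< _ >> - << _ >>); apply/continuousEP => t.
  change (pi *+ 2 * face_vec ord0 (val t) ord0 ord_max = 0 + pi *+ 2).
  rewrite add0r face_vecE /= -[RHS]mulr1 -(simplex_sum t) big_ord1.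
  by congr (_ * sval t _ _); apply/val_inj; rewrite /= inordK.
change (pi *+ 2 * face_vec (fintype.lift ord0 ord0) (val t) ord0 ord_max = 0 :> R).
by rewrite face_vecE (_ : _ == _ = true) ?mulr0.
Qed.

(** The chase of [circle_acyclic] with [e] in degree 0, where it bounds only after [a] times a point
    is subtracted. The resulting defect [a (1 - tau)] of the point is minus the boundary of [a]
    times [path2pi], which explains the correction and the final sign. *)
Lemma circle_H1_span (c : C S1 1) : d S1 1 c = 0 ->
  exists a c', d S1 2 c' = c - a *: << circle_loop >>.
Proof.
move=> dc; have pd : p _# 0 (d R 1 (lift_chain 1 c)) = 0.
  by rewrite (@chain_map_boundary _ _ _ _ _ 1) lift_chainK.
have [e de] := ker_circle_exp pd.
have [g dg] := line_boundary0 e; set a := augmentation _ _ _ _ in dg.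
have /line_acyclic[h dh] :
    d R 1 (lift_chain 1 c - (g - tau _# 1 g) + a *: << path2pi >>) = 0.
  rewrite linearD linearZZ [d _ _ (_ - _)]linearB [d _ _ (g - _)]linearB.
  rewrite -(@chain_map_boundary _ _ _ _ _ 1) dg de boundary_path2pi.
  have -> : tau _# 0 (e - a *: << line_point >>) =
      tau _# 0 e - a *: tau _# 0 << line_point >> by rewrite linearB linearZZ.
  have shuffle (V : zmodType) (x A P Q : V) : x - A - (x - P - (A - Q)) + (Q - P) = 0.
    rewrite opprB (addrA (x - A)) (addrA (x - A)) subrK opprB (addrC (x - Q)).
    by rewrite (addrA (P - x)) subrK addrA subrK subrr.
  transitivity (e - tau _# 0 e - (e - a *: << line_point >> -
      (tau _# 0 e - a *: tau _# 0 << line_point >>)) +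
      (a *: tau _# 0 << line_point >> - a *: << line_point >>)).
    by rewrite -scalerBr.
  exact: shuffle.
exists (- a), (p _# 2 h).
rewrite -(@chain_map_boundary _ _ _ _ _ 2) dh linearD linearZZ linearB.
rewrite [p _# _ (g - _)]linearB circle_exp_tau.
by rewrite lift_chainK subrr subr0 scaleNr opprK chain_map_simplex.
Qed.

(** The connecting homomorphism detects the loop: [a] times [path2pi] minus the boundary of a lift
    of [c] is [(1 - tau) y]. Taking boundaries and using the injectivity of [1 - tau], the boundary
    of [y] is [- a] times a point, and the augmentation gives [a = 0]. *)
Lemma circle_loop_not_boundary (a : F) (c : C S1 2) :
  d S1 2 c = a *: << circle_loop >> -> a = 0.
Proof.
move=> dc.
have /ker_circle_exp[y ey] : p _# 1 (a *: << path2pi >> - d R 2 (lift_chain 2 c)) = 0.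
  rewrite linearB linearZZ (@chain_map_boundary _ _ _ _ _ 2) lift_chainK dc.
  by rewrite chain_map_simplex subrr.
have : d R 1 y + a *: << line_point >> = 0.
  apply: tau_fixed_eq0; rewrite linearD linearZZ (@chain_map_boundary _ _ _ _ _ 1).
  rewrite opprD addrACA -linearB -ey linearB linearZZ boundary_path2pi.
  by rewrite boundary_boundary subr0 -scalerBr -scalerDr addrA subrK subrr scaler0.
move/(congr1 (augmentation R F R)); rewrite linearD linearZZ linear0 /=.
by rewrite augmentation_boundary add0r [augmentation _ _ _ _]fgliftU [_ *: _]mulr1.
Qed.

Lemma circle_H0_span (c : C S1 0) :
  exists c', d S1 1 c' =
    c - augmentation R F S1 c *: << (p \o line_point : continuousType _ _) >>.
Proof.
have [g dg] := line_boundary0 (lift_chain 0 c).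
exists (p _# 1 g).
rewrite -(@chain_map_boundary _ _ _ _ _ 1) dg linearB linearZZ lift_chainK.
by rewrite chain_map_simplex -(augmentation_chain_map p) lift_chainK.
Qed.

End CircleHomology.

Lemma homology_class_eqZ (F : fieldType) (C A B : lmodType F)
    (d1 : {linear C -> A}) (d0 : {linear A -> B}) (z z0 : cycles d0) (a : F) :
  (exists c, d1 c = val z - a *: val z0) <->
  homology_class d1 z = a *: homology_class d1 z0.
Proof.
have -> : a *: homology_class d1 z0 = homology_class d1 (a *: z0).
  exact: homology_class_scale.
split=> [[c dc]|/eqP/homology_classP[c dc]]; last by exists c.
by apply/eqP/homology_classP; exists c.
Qed.

(** * The rank of a map that factors through the circle up to homotopy *)

Section RankThroughCircle.
Variables (R : realType) (F : fieldType) (T Y : topologicalType).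
Local Notation S1 := (@circle R).
Local Notation d X k := (boundary R F X k).
Local Notation "f _# k" := (chain_map R F f k) (at level 2, format "f _# k").
Variables (Phi : continuousType T Y) (mu : continuousType T S1).
Variables (psi : continuousType S1 Y) (delta : continuousType Y S1).
Variables (H : T * R -> Y) (l : singular_simplex R T 1) (x0 : T).
Hypotheses (Hc : continuous H) (H1 : forall x, H (x, 1) = Phi x).
Hypothesis (H0 : forall x, H (x, 0) = psi (mu x)).
Hypothesis (delta_Phi : forall x, delta (Phi x) = mu x).
Hypothesis (dl : d T 1 << l >> = 0).
Hypothesis (mul : (mu \o l : continuousType _ _) = circle_loop R).

Let PhiE :=
  @homotopic_homology_map R F T Y Phi (psi \o mu : continuousType _ _) H Hc H1 H0.

(** Homotopy invariance replaces [Phi] by [psi \o mu], so a relation between two classes of [T] has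
    to hold only after [mu], in the homology of the circle. *)
Let Phi_spanned k (z : cycles (d T k)) (z0 : cycles (d T k)) (a : F) :
  (exists c, d S1 k.+1 c = mu _# k (val z) - a *: mu _# k (val z0)) ->
  singular_homology_map R F Phi k (homology_class _ z) =
  a *: singular_homology_map R F Phi k (homology_class _ z0).
Proof.
move=> [c dc]; rewrite !PhiE.
rewrite /= !(homology_map_class (@chain_map_boundary _ _ _ _ _ k.+1)).
apply/homology_class_eqZ; exists (psi _# k.+1 c).
rewrite -(@chain_map_boundary _ _ _ _ _ k.+1) dc linearB linearZZ !chain_map_comp.
by [].
Qed.

Let Phi_eq0 k (z : cycles (d T k)) :
  singular_homology_map R F Phi k (homology_class _ z) = 0 ->
  exists c, d Y k.+1 c = Phi _# k (val z).
Proof.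
rewrite /= (homology_map_class (@chain_map_boundary _ _ _ _ _ k.+1)).
rewrite -(scale0r (homology_class _ 0)) => /homology_class_eqZ[c dc].
by exists c; rewrite dc scale0r subr0.
Qed.

Lemma rank_through_circle_high k : (2 <= k)%N ->
  has_rank (singular_homology_map R F Phi k) 0.
Proof.
case: k => [//|[//|k]] _; exists (fun=> 0); split=> [[]//|c _ []//|u].
exists (fun=> 0); rewrite big_ord0 -(homology_class_repr u).
move: (repr u) => z; rewrite (@Phi_spanned _ z 0 0) ?scale0r//.
have dz : d S1 k.+2 (mu _# k.+2 (val z)) = 0.
  by rewrite -chain_map_boundary (eqP (cycleP z)) linear0.
by have [c dc] := circle_acyclic dz; exists c; rewrite ?scale0r subr0.
Qed.

(** The image of [l] spans since [mu] carries [l] to the generator of the circle. It is independent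
    since [delta] would turn a chain bounding a multiple of it into one bounding that multiple of
    [circle_loop]. *)
Lemma rank_through_circle1 : has_rank (singular_homology_map R F Phi 1) 1.
Proof.
have lP : << l >> \in is_cycle (d T 1) by rewrite inE; apply/eqP.
pose z0 : cycles (d T 1) := Cycle lP.
have ml : mu _# 1 (val z0) = << circle_loop R >>.
  by rewrite -mul; exact: chain_map_simplex.
exists (fun=> singular_homology_map R F Phi 1 (homology_class _ z0)).
split=> [i|c|u]; first by exists (homology_class _ z0).
  rewrite big_ord1 -linearZZ => c0 i; rewrite (ord1 i).
  have [|c' dc'] := @Phi_eq0 1 (c ord0 *: z0).
    by rewrite -c0; congr (singular_homology_map _ _ _ _ _); symmetry;
      exact: homology_class_scale.
  apply: (@circle_loop_not_boundary R F _ (delta _# 2 c')).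
  rewrite -(@chain_map_boundary _ _ _ _ _ 2) dc' chain_map_comp.
  have -> : (delta \o Phi : continuousType _ _) = mu by apply/continuousEP.
  have -> : val (c ord0 *: z0) = c ord0 *: val z0 by [].
  by rewrite linearZZ ml.
rewrite -(homology_class_repr u); move: (repr u) => z.
have dz : d S1 1 (mu _# 1 (val z)) = 0.
  by rewrite -chain_map_boundary (eqP (cycleP z)) linear0.
have [a [c dc]] := circle_H1_span dz; exists (fun=> a).
by rewrite big_ord1; apply: Phi_spanned; exists c; rewrite ml.
Qed.

(** Any point of [T] gives the spanning class; its multiples are told apart by the augmentation,
    which chain maps preserve and which kills boundaries. *)
Lemma rank_through_circle0 : has_rank (singular_homology_map R F Phi 0) 1.
Proof.
pose s0 : singular_simplex R T 0 := @cone_point R T x0.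
have sP : << s0 >> \in is_cycle (d T 0) by rewrite inE.
pose z0 : cycles (d T 0) := Cycle sP.
have aug0 : augmentation R F T (val z0) = 1 := fgliftU _ _.
exists (fun=> singular_homology_map R F Phi 0 (homology_class _ z0)).
split=> [i|c|u]; first by exists (homology_class _ z0).
  rewrite big_ord1 -linearZZ => c0 i; rewrite (ord1 i).
  have [|c' /(congr1 (augmentation R F Y))] := @Phi_eq0 0 (c ord0 *: z0).
    by rewrite -c0; congr (singular_homology_map _ _ _ _ _); symmetry;
      exact: homology_class_scale.
  have -> : val (c ord0 *: z0) = c ord0 *: val z0 by [].
  rewrite augmentation_boundary augmentation_chain_map linearZZ.
  by rewrite aug0 [_ *: _]mulr1.
rewrite -(homology_class_repr u); move: (repr u) => z.
have [c dc] := circle_H0_span (mu _# 0 (val z)).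
have [c0 dc0] := circle_H0_span (mu _# 0 (val z0)).
exists (fun=> augmentation R F T (val z)).
rewrite big_ord1; apply: Phi_spanned; exists (c - augmentation R F T (val z) *: c0).
rewrite linearB linearZZ dc dc0 !augmentation_chain_map aug0 scale1r scalerBr.
by rewrite opprB addrA subrK.
Qed.

End RankThroughCircle.

(** * Unitary maps and the homotopy through U(n) *)

Section UnitaryMaps.
Variables (R : realType) (n : nat).
Local Notation V := 'rV[R]_(n + n).
Implicit Types (z v w : V) (u : 'I_n -> R).

Definition sqnorm z : R := \sum_i (re z i ^+ 2 + im z i ^+ 2).

(** A real linear map that preserves both the norm and the symplectic form is unitary. The
    continuous left inverse makes the restriction to an ellipsoid a homeomorphism onto its image. *)
Definition unitary_fun (L : V -> V) : Prop :=
  [/\ linear L, continuous L, forall z, sqnorm (L z) = sqnorm z,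
      forall v w, symp_form (L v) (L w) = symp_form v w &
      exists2 L', continuous L' & cancel L L'].

Lemma unitary_fun_id : unitary_fun id.
Proof. by split=> // [z|]; [exact: cvg_id|exists id => // z; exact: cvg_id]. Qed.

Lemma unitary_fun_comp (L M : V -> V) :
  unitary_fun L -> unitary_fun M -> unitary_fun (L \o M).
Proof.
move=> [Ll Lc Ln Ls [L' Lc' LK]] [Ml Mc Mn Ms [M' Mc' MK]]; split.
- by move=> k v w /=; rewrite Ml Ll.
- exact: continuous_compose.
- by move=> z /=; rewrite Ln Mn.
- by move=> v w /=; rewrite Ls Ms.
- by exists (M' \o L'); [exact: continuous_compose|exact: can_comp].
Qed.

Lemma reZD (k : R) v w i : re (k *: v + w) i = k * re v i + re w i.
Proof. by rewrite /re !mxE. Qed.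

Lemma imZD (k : R) v w i : im (k *: v + w) i = k * im v i + im w i.
Proof. by rewrite /im !mxE. Qed.

Section RankOne.
Variables (c s : R) (u : 'I_n -> R).

Let P z := \sum_j re z j * u j.
Let Q z := \sum_j im z j * u j.

(* z |-> z + (c + i s - 1) <z, u> u *)
Definition rank_one z : V :=
  row_mx (\row_i (re z i + ((c - 1) * P z - s * Q z) * u i))
         (\row_i (im z i + (s * P z + (c - 1) * Q z) * u i)).

Lemma re_rank_one z i :
  re (rank_one z) i = re z i + ((c - 1) * P z - s * Q z) * u i.
Proof. by rewrite /re /rank_one row_mxEl mxE. Qed.

Lemma im_rank_one z i :
  im (rank_one z) i = im z i + (s * P z + (c - 1) * Q z) * u i.
Proof. by rewrite /im /rank_one row_mxEr mxE. Qed.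

Let PZD k v w : P (k *: v + w) = k * P v + P w.
Proof.
rewrite /P mulr_sumr -big_split; apply: eq_bigr => i _.
by rewrite reZD mulrDl mulrA.
Qed.

Let QZD k v w : Q (k *: v + w) = k * Q v + Q w.
Proof.
rewrite /Q mulr_sumr -big_split; apply: eq_bigr => i _.
by rewrite imZD mulrDl mulrA.
Qed.

Lemma rank_one_linear : linear rank_one.
Proof.
move=> k v w; apply: reimP => i.
  by rewrite reZD !re_rank_one reZD PZD QZD; ring.
by rewrite imZD !im_rank_one imZD PZD QZD; ring.
Qed.

Let sum_rank_one (f g : 'I_n -> R) (al be : R) :
  \sum_i u i ^+ 2 = 1 ->
  \sum_i (f i + al * u i) * (g i + be * u i) =
  \sum_i f i * g i + be * (\sum_i f i * u i) + al * (\sum_i g i * u i) + al * be.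
Proof.
move=> u1; rewrite -[X in _ = _ + X]mulr1 -u1 !mulr_sumr -!big_split /=.
by apply: eq_bigr => i _; ring.
Qed.

Hypotheses (cs1 : c ^+ 2 + s ^+ 2 = 1) (u1 : \sum_i u i ^+ 2 = 1).

Lemma sqnorm_rank_one z : sqnorm (rank_one z) = sqnorm z.
Proof.
rewrite /sqnorm !big_split /=.
under eq_bigr do rewrite re_rank_one expr2.
under [X in _ + X]eq_bigr do rewrite im_rank_one expr2.
rewrite !sum_rank_one// -/(P z) -/(Q z).
under [in RHS]eq_bigr do rewrite expr2.
under [X in _ = _ + X]eq_bigr do rewrite expr2.
have s2 : s ^+ 2 = 1 - c ^+ 2 by rewrite -cs1 addrAC subrr add0r.
(* The coefficient in front of the last factor is [c ^+ 2 + s ^+ 2 - 1]. *)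
transitivity (\sum_i re z i * re z i + \sum_i im z i * im z i +
  (2 * (c - 1) + (c - 1) ^+ 2 + s ^+ 2) * (P z ^+ 2 + Q z ^+ 2)); first by ring.
by rewrite s2 (_ : 2 * (c - 1) + _ + _ = 0) ?mul0r ?addr0//; ring.
Qed.

Lemma symp_form_rank_one v w : symp_form (rank_one v) (rank_one w) = symp_form v w.
Proof.
rewrite /symp_form !big_split /= !sumrN.
under eq_bigr do rewrite re_rank_one im_rank_one.
under [X in _ - X]eq_bigr do rewrite re_rank_one im_rank_one.
rewrite !sum_rank_one// -!/(P _) -!/(Q _).
have s2 : s ^+ 2 = 1 - c ^+ 2 by rewrite -cs1 addrAC subrr add0r.
transitivity (\sum_i re v i * im w i - \sum_i im v i * re w i +
  (2 * (c - 1) + (c - 1) ^+ 2 + s ^+ 2) * (P v * Q w - Q v * P w)); first by ring.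
by rewrite s2 (_ : 2 * (c - 1) + _ + _ = 0) ?mul0r ?addr0//; ring.
Qed.

End RankOne.

(** For a fixed unit vector the maps [rank_one] multiply like the complex numbers [c + i s]. This
    gives their inverses, and it collapses the homotopy to a circle once all its vectors agree. *)
Lemma rank_one_comp c s c' s' u z : \sum_i u i ^+ 2 = 1 ->
  rank_one c s u (rank_one c' s' u z) =
  rank_one (c * c' - s * s') (s * c' + c * s') u z.
Proof.
move=> u1.
have Pr (f : 'I_n -> R) (al : R) :
    \sum_j (f j + al * u j) * u j = \sum_j f j * u j + al.
  rewrite -[X in _ = _ + X]mulr1 -u1 mulr_sumr -big_split /=.
  by apply: eq_bigr => i _; ring.
have PE : \sum_j re (rank_one c' s' u z) j * u j =
    \sum_j re z j * u j + ((c' - 1) * (\sum_j re z j * u j) - s' * (\sum_j im z j * u j)).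
  by under eq_bigr do rewrite re_rank_one; exact: Pr.
have QE : \sum_j im (rank_one c' s' u z) j * u j =
    \sum_j im z j * u j + (s' * (\sum_j re z j * u j) + (c' - 1) * (\sum_j im z j * u j)).
  by under eq_bigr do rewrite im_rank_one; exact: Pr.
apply: reimP => i.
  by rewrite !re_rank_one PE QE; ring.
by rewrite !im_rank_one PE QE; ring.
Qed.

Lemma rank_one1 u z : rank_one 1 0 u z = z.
Proof.
apply: reimP => i; rewrite ?re_rank_one ?im_rank_one; ring.
Qed.

Lemma rank_one_joint_continuous (T : topologicalType) (c s : T -> R)
    (u : T -> 'I_n -> R) (z : T -> V) :
  continuous c -> continuous s -> (forall i, continuous (fun t => u t i)) ->
  continuous z -> continuous (fun t => rank_one (c t) (s t) (u t) (z t)).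
Proof.
move=> cc sc uc zc; apply: mx_continuous => i j; rewrite (ord1 i).
have zjc k : continuous (fun t => z t ord0 k).
  by apply: (continuous_compose (@coord_continuous _ _ _ ord0 k)).
have Pc : continuous (fun t => \sum_j re (z t) j * u t j).
  by apply: cont_sum => k; apply: cont_mul; [exact: zjc|exact: uc].
have Qc : continuous (fun t => \sum_j im (z t) j * u t j).
  by apply: cont_sum => k; apply: cont_mul; [exact: zjc|exact: uc].
have c1 : continuous (fun t => c t - 1) by apply: cont_sub => //; exact: cont_cst.
case: (split_ordP j) => k ->.
  under eq_fun do rewrite -/(re _ _) re_rank_one.
  apply: cont_add; first exact: zjc.
  by apply: cont_mul => //; apply: cont_sub; exact: cont_mul.
under eq_fun do rewrite -/(im _ _) im_rank_one.
apply: cont_add; first exact: zjc.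
by apply: cont_mul => //; apply: cont_add; exact: cont_mul.
Qed.

Lemma rank_one_continuous c s u : continuous (rank_one c s u).
Proof.
apply: (@rank_one_joint_continuous V (fun=> c) (fun=> s) (fun=> u) id) => [||i|z].
- exact: cont_cst.
- exact: cont_cst.
- exact: cont_cst.
- exact: cvg_id.
Qed.

Lemma rank_one_unitary c s u : c ^+ 2 + s ^+ 2 = 1 -> \sum_i u i ^+ 2 = 1 ->
  unitary_fun (rank_one c s u).
Proof.
move=> cs u1; split.
- exact: rank_one_linear.
- exact: rank_one_continuous.
- exact: sqnorm_rank_one.
- exact: symp_form_rank_one.
- exists (rank_one c (- s) u); first exact: rank_one_continuous.
  move=> z; rewrite rank_one_comp//.
  rewrite (_ : c * c - - s * s = 1); last by rewrite -cs; ring.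
  by rewrite (_ : - s * c + c * s = 0) ?rank_one1//; ring.
Qed.

Definition unit_vec (k : 'I_n) (i : 'I_n) : R := (i == k)%:R.

Lemma sum_unit_vec k (f : 'I_n -> R) : \sum_i f i * unit_vec k i = f k.
Proof.
rewrite (bigD1 k)//= /unit_vec eqxx mulr1 big1 ?addr0// => i /negbTE ->.
by rewrite mulr0.
Qed.

Lemma sum_sqr_unit_vec k : \sum_i unit_vec k i ^+ 2 = 1.
Proof.
by under eq_bigr do rewrite expr2; rewrite sum_unit_vec /unit_vec eqxx.
Qed.

Section SympEmbOfUnitary.
Variables (a b : 'I_n -> R) (amax bmin : R).
Hypotheses (a_gt0 : forall i, 0 < a i) (a_le : forall i, a i <= amax).
Hypotheses (bmin_gt0 : 0 < bmin) (b_ge : forall i, bmin <= b i).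
Hypothesis (ab : amax < bmin).

(** Round balls are inserted between the ellipsoids: [E(a)] lies in the one of capacity [amax],
    which unitary maps preserve, and that of capacity [bmin] lies in [E(b)]. *)
Lemma unitary_interior L (q : ellipsoid a) : unitary_fun L ->
  (ellipsoid b)^° (L (val q)).
Proof.
move=> [_ _ Ln _ _]; apply: ellipsoid_interior.
have qa : ellipsoid_fun a (val q) <= 1 := set_valP q.
have pi0 := pi_ge0 R.
have N0 z i : 0 <= pi * (re z i ^+ 2 + im z i ^+ 2).
  by rewrite mulr_ge0// addr_ge0 ?sqr_ge0.
have leb z : ellipsoid_fun b z <= pi * sqnorm z / bmin.
  rewrite /sqnorm mulr_sumr mulr_suml; apply: ler_sum => i _.
  by rewrite ler_wpM2l// lef_pV2 ?posrE// (lt_le_trans bmin_gt0).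
have gea z : pi * sqnorm z <= amax * ellipsoid_fun a z.
  rewrite /sqnorm !mulr_sumr; apply: ler_sum => i _.
  rewrite mulrCA ler_peMr// ler_pdivlMr// mul1r; exact: a_le.
apply: le_lt_trans (leb _) _; rewrite Ln ltr_pdivrMr// mul1r.
apply: le_lt_trans (gea _) _.
(* If [n = 0], no [a i] forces [amax] to be positive. *)
have [am0|am0] := leP 0 amax.
  by apply: le_lt_trans ab; rewrite -[leRHS]mulr1 ler_wpM2l.
apply: le_lt_trans bmin_gt0; rewrite mulr_le0_ge0 ?(ltW am0)//.
by apply: sumr_ge0 => i _; rewrite divr_ge0// ltW.
Qed.

Section OneMap.
Variables (L : V -> V) (LU : unitary_fun L).

Let Llin : linear L. Proof. by case: LU. Qed.
Let Lc : continuous L. Proof. by case: LU. Qed.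

Let LL : {linear V -> V} := HB.pack L (GRing.isLinear.Build R V V _ L Llin).

Lemma iter_partial_unitary l :
  iter_partial l L = fun z =>
    match l with [::] => L z | [:: j] => L (delta_mx 0 j) | _ => 0 end.
Proof.
elim: l => [//|j l IH]; apply/funext => z /=; rewrite IH {IH}.
case: l => [|k [|? l]] /=.
- change ('D_(delta_mx 0 j) LL z = LL (delta_mx 0 j)).
  rewrite deriveE; last exact/linear_differentiable.
  by rewrite diff_lin.
- exact: derive_cst.
- exact: derive_cst.
Qed.

Definition unitary_on (q : ellipsoid a) : V := L (val q).

Lemma unitary_smooth U : smooth_on U L.
Proof.
move=> l z _; rewrite iter_partial_unitary.
case: l => [|k [|? l]]; last 2 first.
- exact: differentiable_cst.
- exact: differentiable_cst.
exact: (@linear_differentiable _ _ _ LL).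
Qed.

Lemma unitary_extension (q : ellipsoid a) :
  local_extension unitary_on (val q) L.
Proof.
by exists setT; split=> //; [exact: openT|exact: unitary_smooth].
Qed.

Lemma unitary_partial l (q : ellipsoid a) :
  partial l unitary_on q =
    match l with [::] => L (val q) | [:: j] => L (delta_mx 0 j) | _ => 0 end.
Proof.
rewrite (partialE (@ellipsoid_regular R n a) l (unitary_extension q)).
by rewrite iter_partial_unitary.
Qed.

Lemma unitary_differential (q : ellipsoid a) : differential unitary_on q = L.
Proof.
rewrite (differentialE (@ellipsoid_regular R n a) (unitary_extension q)).
by rewrite (_ : L = LL)// diff_lin.
Qed.

Lemma unitary_embedding : smooth_embedding unitary_on.
Proof.
have [_ _ _ _ [L' Lc' LK]] := LU; split.
- by move=> q; exists L; exact: unitary_extension.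
- by move=> q q1 /(can_inj LK) /val_inj.
- by move=> q; rewrite unitary_differential; exact: can_inj LK.
- move=> U [G oG <-]; exists (L' @^-1` G).
    by apply: open_comp => // z _; exact: Lc'.
  by apply/seteqP; split => q /=; rewrite /unitary_on LK.
Qed.

Lemma unitary_symplectic : symplectic unitary_on.
Proof. by move=> q v w; rewrite unitary_differential; case: LU. Qed.

Definition unitary_sympemb : SympEmb a b :=
  @MkSympEmb R n a b unitary_on unitary_embedding
    (fun q => unitary_interior q LU) unitary_symplectic.

End OneMap.

Lemma sympemb_eq (f g : SympEmb a b) : (forall q, f q = g q) -> f = g.
Proof.
case: f g => [f f1 f2 f3] [g g1 g2 g3] /= /funext fg; subst g.
by congr MkSympEmb; exact: Prop_irrelevance.
Qed.

(** The topology is initial for the jets, so each iterated partial derivative is treated alone. For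
    a linear map it is the map itself, the image of a basis vector or 0, in each case jointly
    continuous in parameter and point; currying then lands continuously in the compact-open
    topology. *)
Lemma unitary_sympemb_continuous (T : topologicalType) (L : T -> V -> V)
    (LU : forall t, unitary_fun (L t)) :
  continuous (fun p : T * V => L p.1 p.2) ->
  continuous (fun t => unitary_sympemb (LU t)).
Proof.
move=> Lc; apply: continuous_comp_initial => t.
apply/cvg_sup => l.
move: t; apply: (@continuous_comp_initial
  (prod_topology (fun _ : seq 'I_(n + n) =>
     {compact-open, ellipsoid a -> V})) T _ (@^~ l)).
pose g (x : T * ellipsoid a) : V :=
  match l with
  | [::] => L x.1 (val x.2)
  | [:: j] => L x.1 (delta_mx 0 j)
  | _ => 0
  end.
rewrite [X in continuous X](_ : _ = curry g); last first.
  by apply/funext => t; apply/funext => q; exact: unitary_partial.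
apply: continuous_curry_fun.
have Lc2 (z : T * ellipsoid a -> V) : continuous z ->
    continuous (fun x => L x.1 (z x)).
  move=> zc; apply: (@continuous_compose _ _ _ (fun p : T * V => L p.1 p.2)
    (fun x : T * ellipsoid a => (x.1, z x))) => //.
  by apply: continuous_pair => //; exact: continuous_fst.
rewrite /g; case: (l) => [|j [|? ?]].
- apply: Lc2; apply: continuous_compose; last exact: continuous_snd.
  exact: initial_continuous.
- by apply: Lc2 => x; exact: cvg_cst.
- by move=> x; exact: cvg_cst.
Qed.

End SympEmbOfUnitary.

End UnitaryMaps.

(** * Homotopy from the torus action to a rotation of the first coordinate *)

Section Whitehead.
Variables (R : realType) (n : nat).
Local Notation V := 'rV[R]_(n.+1 + n.+1).
Local Notation T := (torus R n.+1).

(* At time 1 the j-th factor of turning_map rotates the j-th coordinate, at time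
   0 all factors rotate the first one. *)
Definition turning_vec (t : R) (j i : 'I_n.+1) : R :=
  if j == ord0 then unit_vec R ord0 i
  else cos (t * (pi / 2)) * unit_vec R ord0 i + sin (t * (pi / 2)) * unit_vec R j i.

Lemma turning_vec0 j : turning_vec 0 j = unit_vec R ord0.
Proof.
apply/funext => i; rewrite /turning_vec mul0r cos0 sin0 mul1r mul0r addr0.
by case: ifP.
Qed.

Lemma turning_vec1 j : turning_vec 1 j = unit_vec R j.
Proof.
apply/funext => i; rewrite /turning_vec mul1r cos_pihalf sin_pihalf mul1r mul0r add0r.
by case: eqP => [->|].
Qed.

Lemma sum_sqr_turning_vec t j : \sum_i turning_vec t j i ^+ 2 = 1.
Proof.
rewrite /turning_vec; have [_|j0] := eqVneq j ord0; first exact: sum_sqr_unit_vec.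
set c := cos _; set s := sin _.
rewrite (bigD1 ord0)//= (bigD1 j)//= big1 => [|i /andP[i0 ij]]; last first.
  by rewrite /unit_vec (negbTE i0) (negbTE ij) !mulr0 addr0 expr0n.
rewrite /unit_vec !eqxx (negbTE j0) [ord0 == j]eq_sym (negbTE j0) !mulr0 !mulr1.
by rewrite !addr0 add0r cos2Dsin2.
Qed.

Lemma turning_vec_continuous j i : continuous (fun t => turning_vec t j i).
Proof.
rewrite /turning_vec; case: eqP => _; first exact: cont_cst.
have tc : continuous (fun t : R => t * (pi / 2)).
  by apply: cont_mul => t; [exact: cvg_id|exact: cvg_cst].
apply: cont_add; apply: cont_mul; do ?exact: cont_cst.
  exact: continuous_compose (@continuous_cos R) tc.
exact: continuous_compose (@continuous_sin R) tc.
Qed.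

(** Conjugating a rotation of the first coordinate by a real rotation of the plane of coordinates 0
    and [j] merely moves its axis, so the conjugation is encoded by the moving unit vector of
    [rank_one]. *)
Definition turning_map (x : T * R) (l : seq 'I_n.+1) : V -> V :=
  foldr (fun j f => rank_one (torus_cos x.1 j) (torus_sin x.1 j)
                      (turning_vec x.2 j) \o f) id l.

Lemma turning_map_unitary x l : unitary_fun (turning_map x l).
Proof.
elim: l => [|j l IH]; first exact: unitary_fun_id.
apply: unitary_fun_comp IH; apply: rank_one_unitary.
  exact: torus_cos2Dsin2.
exact: sum_sqr_turning_vec.
Qed.

Lemma turning_map_continuous l :
  continuous (fun p : (T * R) * V => turning_map p.1 l p.2).
Proof.
elim: l => [|j l IH]; first exact: continuous_snd.
have c11 : continuous (fun p : (T * R) * V => p.1.1).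
  by apply: continuous_compose; exact: continuous_fst.
have c12 : continuous (fun p : (T * R) * V => p.1.2).
  by apply: continuous_compose; [exact: continuous_snd|exact: continuous_fst].
apply: rank_one_joint_continuous => //.
- exact: continuous_compose (@torus_cos_continuous R n.+1 j) c11.
- exact: continuous_compose (@torus_sin_continuous R n.+1 j) c11.
- by move=> i; exact: continuous_compose (@turning_vec_continuous j i) c12.
Qed.

Lemma turning_map1 th z : turning_map (th, 1) (enum 'I_n.+1) z = unitary_map th z.
Proof.
(* The induction needs partial products: over a list without repetition, exactly the listed
   coordinates are rotated, each of them once. *)
have E l : uniq l -> forall i,
    re (turning_map (th, 1) l z) i =
      (if i \in l then torus_cos th i * re z i - torus_sin th i * im z i else re z i) /\
    im (turning_map (th, 1) l z) i =
      (if i \in l then torus_sin th i * re z i + torus_cos th i * im z i else im z i).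
  elim: l => [//|j l IH] /= /andP[jl ul] i.
  rewrite re_rank_one im_rank_one turning_vec1 !sum_unit_vec.
  have [rj ij] := IH ul j; have [ri ii] := IH ul i.
  rewrite rj ij ri ii (negbTE jl) inE /unit_vec.
  have [->|nij] := eqVneq i j; last by rewrite !mulr0 !addr0.
  by rewrite (negbTE jl) /=; split; ring.
apply: reimP => i; have [r1 i1] := E _ (enum_uniq 'I_n.+1) i.
  by rewrite r1 mem_enum re_rotation.
by rewrite i1 mem_enum im_rotation.
Qed.

Definition angle_prod (th : T) (l : seq 'I_n.+1) : R * R :=
  foldr (fun j p => (torus_cos th j * p.1 - torus_sin th j * p.2,
                     torus_sin th j * p.1 + torus_cos th j * p.2)) (1, 0) l.

Lemma angle_prod_circle th l : angle_prod th l \in @circle R.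
Proof.
rewrite inE /circle /=; elim: l => [|j l IH] /=; first by rewrite expr1n expr0n addr0.
transitivity ((torus_cos th j ^+ 2 + torus_sin th j ^+ 2) *
  ((angle_prod th l).1 ^+ 2 + (angle_prod th l).2 ^+ 2)); first by ring.
by rewrite torus_cos2Dsin2 mul1r.
Qed.

Lemma angle_prod_continuous l : continuous (fun th : T => angle_prod th l).
Proof.
elim: l => [|j l IH]; first by apply: continuous_pair; exact: cont_cst.
have c1 := continuous_compose (@continuous_fst R R) IH.
have c2 := continuous_compose (@continuous_snd R R) IH.
have cc := @torus_cos_continuous R n.+1 j.
have cs := @torus_sin_continuous R n.+1 j.
apply: continuous_pair; first by apply: cont_sub; exact: cont_mul.
by apply: cont_add; exact: cont_mul.
Qed.

Definition total_angle_fun (th : T) : @circle R :=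
  exist _ (angle_prod th (enum 'I_n.+1)) (angle_prod_circle th _).

Lemma total_angle_continuous : continuous total_angle_fun.
Proof. by apply: continuous_comp_initial; exact: angle_prod_continuous. Qed.

Definition total_angle : continuousType T (@circle R) := mkcts total_angle_continuous.

Lemma turning_map0 th l z : turning_map (th, 0) l z =
  rank_one (angle_prod th l).1 (angle_prod th l).2 (unit_vec R ord0) z.
Proof.
elim: l => [|j l IH] /=; first by rewrite rank_one1.
by rewrite IH turning_vec0 rank_one_comp ?sum_sqr_unit_vec.
Qed.

Definition angle_pi (x : R) : angle R := \pi_(Quotient.quot (@two_piZ R))%qT x.

Lemma angle_pi_continuous : continuous angle_pi.
Proof. exact: pi_continuous. Qed.

Lemma angle_repr_pi (f : R -> R) x : periodic f (pi *+ 2) ->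
  f (angle_repr (angle_pi x)) = f x.
Proof.
move=> fT; have /eqP : \pi_(Quotient.quot (@two_piZ R))%qT (angle_repr (angle_pi x)) =
    \pi_(Quotient.quot (@two_piZ R))%qT x by exact: reprK.
rewrite -Quotient.idealrBE => /asboolP[m xy].
by rewrite -[angle_repr _](subrK x) xy addrC periodicz.
Qed.

Lemma angle_pi2pi : angle_pi (pi *+ 2) = angle_pi 0.
Proof.
suff /eqP : (\pi_(Quotient.quot (@two_piZ R)) (pi *+ 2) ==
  \pi_(Quotient.quot (@two_piZ R)) 0)%qT by [].
by rewrite -Quotient.idealrBE; apply/asboolP; exists 1; rewrite subr0.
Qed.

(** Only the first angle turns, so the product of the phases runs exactly through [circle_loop]. *)
Definition torus_loop_fun (t : @simplex R 1) : T :=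
  fun i => if i == ord0 then angle_pi (path2pi R t) else angle_pi 0.

Lemma torus_loop_continuous : continuous torus_loop_fun.
Proof.
move=> t; apply/cvg_sup => [|i]; first exact/fmap_filter/nbhs_filter.
move: t.
apply: (@continuous_comp_initial (prod_topology (fun _ : 'I_n.+1 => angle R))
  (@simplex R 1) _ (@^~ i)).
rewrite (_ : _ \o _ = fun t => angle_pi (if i == ord0 then path2pi R t else 0)).
  apply: (continuous_compose angle_pi_continuous).
  by case: eqP => _; [exact: cts_fun|exact: cont_cst].
by apply/funext => t; rewrite /torus_loop_fun /=; case: ifP.
Qed.

Definition torus_loop : singular_simplex R T 1 := mkcts torus_loop_continuous.

Lemma torus_loop_cycle (F : fieldType) : boundary R F T 1 << torus_loop >> = 0.
Proof.
rewrite boundary_simplex !big_ord_recl big_ord0 addr0 expr0 expr1 scale1r scaleN1r.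
suff -> : (torus_loop \o face R (fintype.lift ord0 ord0) : continuousType _ _) =
  (torus_loop \o face R ord0 : continuousType _ _) by rewrite subrr.
apply/continuousEP => t; apply/funext => i.
change ((if i == ord0 then angle_pi (path2pi R (face_fun (fintype.lift ord0 ord0) t))
         else angle_pi 0) =
        (if i == ord0 then angle_pi (path2pi R (face_fun ord0 t)) else angle_pi 0)).
have -> : path2pi R (face_fun (fintype.lift ord0 ord0) t) = 0.
  change (pi *+ 2 * face_vec (fintype.lift ord0 ord0) (val t) ord0 ord_max = 0 :> R).
  by rewrite face_vecE (_ : _ == _ = true) ?mulr0.
have -> : path2pi R (face_fun ord0 t) = pi *+ 2.
  change (pi *+ 2 * face_vec ord0 (val t) ord0 ord_max = pi *+ 2 :> R).
  rewrite face_vecE /= -[RHS]mulr1 -(simplex_sum t) big_ord1.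
  by congr (_ * sval t _ _); apply/val_inj; rewrite /= inordK.
by rewrite angle_pi2pi.
Qed.

Lemma total_angle_loop :
  (total_angle \o torus_loop : continuousType _ _) = circle_loop R.
Proof.
apply/continuousEP => t.
have tc i : torus_cos (torus_loop t) i =
    if i == ord0 then cos (path2pi R t) else 1.
  change (torus_cos (torus_loop_fun t) i =
    if i == ord0 then cos (path2pi R t) else 1).
  rewrite /torus_cos /torus_loop_fun; case: ifP => _.
    exact: angle_repr_pi (@cosD2pi R).
  by rewrite (angle_repr_pi _ (@cosD2pi R)) cos0.
have ts i : torus_sin (torus_loop t) i =
    if i == ord0 then sin (path2pi R t) else 0.
  change (torus_sin (torus_loop_fun t) i =
    if i == ord0 then sin (path2pi R t) else 0).
  rewrite /torus_sin /torus_loop_fun; case: ifP => _.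
    exact: angle_repr_pi (@sinD2pi R).
  by rewrite (angle_repr_pi _ (@sinD2pi R)) sin0.
have E l : uniq l -> angle_prod (torus_loop t) l =
    if ord0 \in l then (cos (path2pi R t), sin (path2pi R t)) else (1, 0).
  elim: l => [//|j l IH] /= /andP[jl ul]; rewrite IH// tc ts inE eq_sym.
  have [j0|j0] := eqVneq j ord0; last by case: ifP; rewrite /= !mul0r !mul1r subr0 add0r.
  by rewrite -j0 (negbTE jl) /= !mulr1 !mulr0 subr0 addr0.
change (total_angle_fun (torus_loop t) = circle_exp_fun (path2pi R t)).
by apply: val_inj; rewrite /= E ?enum_uniq// mem_enum.
Qed.

End Whitehead.

(** * The phase of the differential at the center *)

Section ComplexContinuity.
Variables (R : realType) (T : topologicalType).
Implicit Types f g : T -> complex R.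

Definition complex_continuous f :=
  continuous (fun t => complex.Re (f t)) /\ continuous (fun t => complex.Im (f t)).

Lemma complex_continuous_cst z : complex_continuous (fun=> z).
Proof. by split; exact: cont_cst. Qed.

Lemma ReD (x y : complex R) : complex.Re (x + y) = complex.Re x + complex.Re y.
Proof. by case: x; case: y. Qed.

Lemma ImD (x y : complex R) : complex.Im (x + y) = complex.Im x + complex.Im y.
Proof. by case: x; case: y. Qed.

Lemma ReM (x y : complex R) : complex.Re (x * y) =
  complex.Re x * complex.Re y - complex.Im x * complex.Im y.
Proof. by case: x; case: y. Qed.

Lemma ImM (x y : complex R) : complex.Im (x * y) =
  complex.Re x * complex.Im y + complex.Im x * complex.Re y.
Proof. by case: x; case: y. Qed.

Lemma complex_continuousD f g : complex_continuous f -> complex_continuous g ->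
  complex_continuous (fun t => f t + g t).
Proof.
move=> [fr fi] [gr gi]; split.
  by under eq_fun do rewrite ReD; exact: cont_add.
by under eq_fun do rewrite ImD; exact: cont_add.
Qed.

Lemma complex_continuousM f g : complex_continuous f -> complex_continuous g ->
  complex_continuous (fun t => f t * g t).
Proof.
move=> [fr fi] [gr gi]; split.
  by under eq_fun do rewrite ReM; apply: cont_sub; exact: cont_mul.
by under eq_fun do rewrite ImM; apply: cont_add; exact: cont_mul.
Qed.

Lemma complex_continuous_sum (I : Type) (r : seq I) (f : I -> T -> complex R) :
  (forall i, complex_continuous (f i)) ->
  complex_continuous (fun t => \sum_(i <- r) f i t).
Proof.
move=> fc; elim: r => [|i r IH].
  by under eq_fun do rewrite big_nil; exact: complex_continuous_cst.
by under eq_fun do rewrite big_cons; exact: complex_continuousD.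
Qed.

Lemma complex_continuous_prod (I : Type) (r : seq I) (f : I -> T -> complex R) :
  (forall i, complex_continuous (f i)) ->
  complex_continuous (fun t => \prod_(i <- r) f i t).
Proof.
move=> fc; elim: r => [|i r IH].
  by under eq_fun do rewrite big_nil; exact: complex_continuous_cst.
by under eq_fun do rewrite big_cons; exact: complex_continuousM.
Qed.

Lemma complex_continuous_det n (A : T -> 'M[complex R]_n) :
  (forall i j, complex_continuous (fun t => A t i j)) ->
  complex_continuous (fun t => \det (A t)).
Proof.
move=> Ac; apply: complex_continuous_sum => s; apply: complex_continuousM.
  exact: complex_continuous_cst.
by apply: complex_continuous_prod => i; exact: Ac.
Qed.

End ComplexContinuity.

(** * Nonvanishing of the complex determinant on symplectic matrices *)

Section ComplexLinearPart.
Variables (R : realType) (n : nat).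
Local Notation V := 'rV[R]_(n + n).

(* The matrix of the complex linear part (M - J M J) / 2 of the real linear map
   M whose values on the standard basis are given, J being the product by i. *)
Definition complex_part (M : 'I_(n + n) -> V) : 'M[complex R]_n :=
  \matrix_(i, j) Complex
    ((re (M (lshift n i)) j + im (M (rshift n i)) j) / 2)
    ((im (M (lshift n i)) j - re (M (rshift n i)) j) / 2).

Lemma row_mx_delta (p q : 'I_n -> R) :
  (row_mx (\row_i p i) (\row_i q i) : V) =
  \sum_i p i *: delta_mx 0 (lshift n i) + \sum_i q i *: delta_mx 0 (rshift n i).
Proof.
rewrite [LHS]row_sum_delta big_split_ord /=.
by congr (_ + _); apply: eq_bigr => i _; rewrite ?row_mxEl ?row_mxEr mxE.
Qed.

Lemma re_sum (v : 'I_n -> V) j : re (\sum_i v i) j = \sum_i re (v i) j.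
Proof. by rewrite /re summxE. Qed.

Lemma im_sum (v : 'I_n -> V) j : im (\sum_i v i) j = \sum_i im (v i) j.
Proof. by rewrite /im summxE. Qed.

(** If the complex linear part kills [x], then [M x = J w] for [w = M (J x)], so [symp_form (M x) w]
    is minus the squared norm of [w]. Symplecticity equates it with [symp_form x (J x)], the squared
    norm of [x]; hence [x = 0]. *)
Lemma complex_part_det_neq0 (M : {linear V -> V}) :
  (forall u v, symp_form (M u) (M v) = symp_form u v) ->
  \det (complex_part (fun i => M (delta_mx 0 i))) != 0.
Proof.
move=> Ms; apply/negP => /det0P[v v0 vA].
pose p i := complex.Re (v 0 i); pose q i := complex.Im (v 0 i).
(* Row [i] of the matrix is the image of the [i]-th basis vector, so a left kernel vector [v] is the
   right object; [x] is [v] in real coordinates, and [w] is the image under [M] of [i v]. *)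
pose x : V := row_mx (\row_i p i) (\row_i q i).
pose w : V := M (row_mx (\row_i - q i) (\row_i p i)).
pose e i : V := M (delta_mx 0 (lshift n i)).
pose f i : V := M (delta_mx 0 (rshift n i)).
have Mx : M x = \sum_i p i *: e i + \sum_i q i *: f i.
  rewrite /x row_mx_delta linearD !linear_sum.
  by congr (_ + _); apply: eq_bigr => i _; rewrite linearZ.
have wE : w = \sum_i - q i *: e i + \sum_i p i *: f i.
  rewrite /w row_mx_delta linearD !linear_sum.
  by congr (_ + _); apply: eq_bigr => i _; rewrite linearZ.
have reS (y z : V) j : re (y + z) j = re y j + re z j by rewrite /re mxE.
have imS (y z : V) j : im (y + z) j = im y j + im z j by rewrite /im mxE.
have reZ a (y : V) j : re (a *: y) j = a * re y j by rewrite /re mxE.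
have imZ a (y : V) j : im (a *: y) j = a * im y j by rewrite /im mxE.
have ReSum (h : 'I_n -> complex R) : complex.Re (\sum_i h i) = \sum_i complex.Re (h i).
  by apply: (big_morph _ (@ReD R)).
have ImSum (h : 'I_n -> complex R) : complex.Im (\sum_i h i) = \sum_i complex.Im (h i).
  by apply: (big_morph _ (@ImD R)).
have rE j : re (M x) j = - im w j.
  have /matrixP/(_ 0 j) := vA; rewrite !mxE => /(congr1 (@complex.Re R)).
  rewrite ReSum => /(congr1 ( *%R 2)); rewrite mulr0 mulr_sumr => vA0.
  apply/eqP; rewrite -subr_eq0 opprK -[X in _ == X]vA0 Mx wE !reS !imS !re_sum !im_sum.
  rewrite -!big_split /=; apply/eqP; apply: eq_bigr => i _.
  by rewrite mxE ReM /= !reZ !imZ -/(p i) -/(q i) -/(e i) -/(f i); field.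
have iE j : im (M x) j = re w j.
  have /matrixP/(_ 0 j) := vA; rewrite !mxE => /(congr1 (@complex.Im R)).
  rewrite ImSum => /(congr1 ( *%R 2)); rewrite mulr0 mulr_sumr => vA0.
  apply/eqP; rewrite -subr_eq0 -[X in _ == X]vA0 Mx wE !reS !imS !re_sum !im_sum.
  rewrite opprD -!sumrN -!big_split /=; apply/eqP; apply: eq_bigr => i _.
  by rewrite mxE ImM /= !reZ !imZ -/(p i) -/(q i) -/(e i) -/(f i); field.
have := Ms x (row_mx (\row_i - q i) (\row_i p i)); rewrite -/w.
have -> : symp_form (M x) w = - \sum_i (re w i ^+ 2 + im w i ^+ 2).
  by rewrite -sumrN; apply: eq_bigr => i _; rewrite rE iE; ring.
have -> : symp_form x (row_mx (\row_i - q i) (\row_i p i)) =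
    \sum_i (p i ^+ 2 + q i ^+ 2).
  apply: eq_bigr => i _; rewrite /re /im !row_mxEl !row_mxEr !mxE; ring.
move=> E.
have w0 : 0 <= \sum_i (re w i ^+ 2 + im w i ^+ 2).
  by apply: sumr_ge0 => i _; rewrite addr_ge0 ?sqr_ge0.
have pq0 i : 0 <= p i ^+ 2 + q i ^+ 2 by rewrite addr_ge0 ?sqr_ge0.
have S0 : \sum_i (p i ^+ 2 + q i ^+ 2) = 0.
  by apply/eqP; rewrite eq_le -{1}E oppr_le0 w0 sumr_ge0.
move/eqP: v0; apply; apply/rowP => i; rewrite mxE.
have /(_ i isT)/eqP := psumr_eq0P (fun j _ => pq0 j) S0.
rewrite paddr_eq0 ?sqr_ge0// !sqrf_eq0 => /andP[/eqP pi0 /eqP qi0].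
by apply/eqP; rewrite eq_complex -/(p i) -/(q i) pi0 qi0 !eqxx.
Qed.

End ComplexLinearPart.

Lemma compact_open_eval_continuous (T U : topologicalType) (x : T) :
  continuous (fun f : {compact-open, T -> U} => f x).
Proof.
apply/continuousP => B oB.
rewrite (_ : _ @^-1` _ = [set f : {compact-open, T -> U} | f @` [set x] `<=` B]).
  by apply: compact_open_open => //; exact: compact_set1.
apply/seteqP; split => f /= fB; first by move=> _ [y ->] <-.
by apply: fB; exists x.
Qed.

Section SympEmbDet.
Variables (R : realType) (n : nat) (a b : 'I_n -> R).
Local Notation V := 'rV[R]_(n + n).

Lemma ellipsoid0 : (0 : V) \in ellipsoid a.
Proof.
rewrite inE /ellipsoid /= /ellipsoid_fun big1 ?ler01// => i _.
by rewrite /re /im !mxE expr0n addr0 mulr0 mul0r.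
Qed.

Definition ellipsoid_center : ellipsoid a := exist _ 0 ellipsoid0.

Lemma sympemb_partial_continuous (l : seq 'I_(n + n)) (q : ellipsoid a) :
  continuous (fun f : SympEmb a b => partial l f q).
Proof.
apply: (@continuous_compose _ _ _ (fun h : {compact-open, ellipsoid a -> V} => h q)
  (fun f : SympEmb a b => sympemb_jet f l)).
  exact: compact_open_eval_continuous.
apply: (@continuous_compose _ _ _ (fun h : prod_topology (fun _ : seq 'I_(n + n) =>
  {compact-open, ellipsoid a -> V}) => h l) (@sympemb_jet R n a b)).
  exact: (@proj_continuous _
    (fun _ : seq 'I_(n + n) => {compact-open, ellipsoid a -> V})).
exact: initial_continuous.
Qed.

Definition sympemb_det (f : SympEmb a b) : complex R :=
  \det (complex_part (fun i => partial [:: i] f ellipsoid_center)).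

Lemma sympemb_det_neq0 f : sympemb_det f != 0.
Proof.
rewrite /sympemb_det; set q := ellipsoid_center.
have [sf _ _ _] := sympemb_embedding f; have [g fg] := sf q.
have [U [_ Uq sg _]] := germP fg.
have dg : differentiable (germ f q) (val q) := sg [::] _ Uq.
rewrite (_ : (fun i => partial [:: i] f q) =
  (fun i => 'd (germ f q) (val q) (delta_mx 0 i))).
  apply: complex_part_det_neq0 => u v; exact: (sympemb_symplectic f q u v).
by apply/funext => i; rewrite /partial /= deriveE.
Qed.

Lemma sympemb_det_continuous : complex_continuous sympemb_det.
Proof.
apply: complex_continuous_det => i j.
have coordc k h : continuous (fun f : SympEmb a b =>
    partial [:: k] f ellipsoid_center ord0 h).
  apply: (@continuous_compose _ _ _ (fun M : V => M ord0 h)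
    (fun f : SympEmb a b => partial [:: k] f ellipsoid_center)).
    exact: coord_continuous.
  exact: sympemb_partial_continuous.
split.
  under eq_fun do rewrite mxE /=.
  by apply: cont_mul; [apply: cont_add; exact: coordc|exact: cont_cst].
under eq_fun do rewrite mxE /=.
by apply: cont_mul; [apply: cont_sub; exact: coordc|exact: cont_cst].
Qed.

Let modulus (z : complex R) : R := Num.sqrt (complex.Re z ^+ 2 + complex.Im z ^+ 2).

Lemma sympemb_modulus_gt0 f : 0 < modulus (sympemb_det f).
Proof.
have := sympemb_det_neq0 f; case: (sympemb_det f) => x y.
rewrite eq_complex /= negb_and => xy; rewrite sqrtr_gt0 /= lt_neqAle.
rewrite addr_ge0 ?sqr_ge0// andbT eq_sym paddr_eq0 ?sqr_ge0// !sqrf_eq0 negb_and.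
exact: xy.
Qed.

Lemma sympemb_phase_subproof f :
  (complex.Re (sympemb_det f) / modulus (sympemb_det f),
   complex.Im (sympemb_det f) / modulus (sympemb_det f)) \in @circle R.
Proof.
have m0 := sympemb_modulus_gt0 f.
rewrite inE /circle /= !expr_div_n -mulrDl sqr_sqrtr ?addr_ge0 ?sqr_ge0//.
by rewrite mulfV//; move: m0; rewrite /modulus sqrtr_gt0 => /lt0r_neq0.
Qed.

Definition sympemb_phase_fun (f : SympEmb a b) : @circle R :=
  exist _ (complex.Re (sympemb_det f) / modulus (sympemb_det f),
           complex.Im (sympemb_det f) / modulus (sympemb_det f))
    (sympemb_phase_subproof f).

Lemma sympemb_phase_continuous : continuous sympemb_phase_fun.
Proof.
have [rc ic] := sympemb_det_continuous.
have mc : continuous (fun f => modulus (sympemb_det f)).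
  apply: (continuous_compose (@sqrt_continuous R)).
  by apply: cont_add; apply: (continuous_compose (@exprn_continuous R 2)).
apply: continuous_comp_initial; apply: continuous_pair => f.
  apply: (@continuous_at_div R (SympEmb a b) (fun f => complex.Re (sympemb_det f))
    (fun f => modulus (sympemb_det f))); [|exact: rc|exact: mc].
  exact/lt0r_neq0/sympemb_modulus_gt0.
apply: (@continuous_at_div R (SympEmb a b) (fun f => complex.Im (sympemb_det f))
  (fun f => modulus (sympemb_det f))); [|exact: ic|exact: mc].
exact/lt0r_neq0/sympemb_modulus_gt0.
Qed.

Definition sympemb_phase : continuousType (SympEmb a b) (@circle R) :=
  mkcts sympemb_phase_continuous.

End SympEmbDet.

(** A diagonal unitary map is its own differential and is complex linear, so the determinant is the
    product of its diagonal phases; having modulus 1, it is unchanged by normalisation. *)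
Lemma sympemb_phase_Phi (R : realType) (n : nat) (a b : 'I_n.+1 -> R)
    (a_gt0 : forall i, 0 < a i) (lt_ab : forall i, a i < b i) (th : torus R n.+1) :
  sympemb_phase a b (Phi a_gt0 lt_ab th) = total_angle R n th.
Proof.
have dE : sympemb_det (Phi_fun a_gt0 lt_ab th) =
    Complex (angle_prod th (enum 'I_n.+1)).1 (angle_prod th (enum 'I_n.+1)).2.
  rewrite /sympemb_det.
  rewrite (_ : complex_part _ =
      diag_mx (\row_i Complex (torus_cos th i) (torus_sin th i))); last first.
    apply/matrixP => i j; rewrite !mxE.
    have pE k : partial [:: k] (Phi_fun a_gt0 lt_ab th) (ellipsoid_center a) =
        rotation (torus_cos th) (torus_sin th) (delta_mx 0 k).
      exact: (rotation_partial _ _ [:: k]).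
    rewrite !pE !re_rotation !im_rotation /re /im !mxE /=.
    rewrite !(inj_eq (@lshift_inj _ _)) !(inj_eq (@rshift_inj _ _)).
    rewrite !eq_lrshift !eq_rlshift /= [j == i]eq_sym.
    case: (eqVneq i j) => [->|ij] /=; rewrite ?mulr1n ?mulr0n.
      by apply/eqP; rewrite eq_complex /=; apply/andP; split; apply/eqP; field.
    by apply/eqP; rewrite eq_complex /=; apply/andP; split; apply/eqP; field.
  rewrite det_diag -big_enum /=.
  elim: (enum _) => [|j l IH]; first by rewrite big_nil.
  rewrite big_cons IH mxE /=; apply/eqP; rewrite eq_complex /= eqxx /=.
  by rewrite addrC.
change (sympemb_phase_fun (Phi_fun a_gt0 lt_ab th) = total_angle_fun th).
apply: val_inj; rewrite /= dE /=.
have := angle_prod_circle th (enum 'I_n.+1); rewrite inE /circle /= => ->.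
by rewrite sqrtr1 !divr1 -surjective_pairing.
Qed.

(** * Factorization of the torus family through the circle *)

Section PhiFactorization.
Variables (R : realType) (n : nat) (a b : 'I_n.+1 -> R).
Hypothesis (a_gt0 : forall i, 0 < a i).
Hypothesis (a_nd : {homo a : i j / (i <= j)%N >-> i <= j}).
Hypothesis (b_nd : {homo b : i j / (i <= j)%N >-> i <= j}).
Hypothesis (ab : a ord_max < b ord0).
Local Notation lt_ab := (lt_pointwise a_nd b_nd ab).

Let a_le i : a i <= a ord_max. Proof. by apply: a_nd; exact: leq_ord. Qed.
Let b_ge i : b ord0 <= b i. Proof. exact: b_nd. Qed.
Let b0 : 0 < b ord0. Proof. exact: lt_trans ab. Qed.

Let sympemb_of L (LU : unitary_fun L) : SympEmb a b :=
  unitary_sympemb a_gt0 a_le b0 b_ge ab LU.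

Let first_rotation_unitary (p : @circle R) :
  unitary_fun (rank_one (val p).1 (val p).2 (unit_vec R (ord0 : 'I_n.+1))).
Proof.
by apply: rank_one_unitary; [exact: (set_valP p)|exact: sum_sqr_unit_vec].
Qed.

Let psi_continuous : continuous (fun p => sympemb_of (first_rotation_unitary p)).
Proof.
apply: unitary_sympemb_continuous.
have vc : continuous (fun x : @circle R * 'rV[R]_(n.+1 + n.+1) => val x.1).
  by apply: continuous_compose; [exact: initial_continuous|exact: continuous_fst].
apply: rank_one_joint_continuous.
- by apply: continuous_compose vc; exact: continuous_fst.
- by apply: continuous_compose vc; exact: continuous_snd.
- by move=> i; exact: cont_cst.
- exact: continuous_snd.
Qed.

Let H (x : torus R n.+1 * R) : SympEmb a b :=
  sympemb_of (turning_map_unitary x (enum 'I_n.+1)).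

Let H_continuous : continuous H.
Proof. by apply: unitary_sympemb_continuous; exact: turning_map_continuous. Qed.

Let H1 th : H (th, 1) = Phi a_gt0 lt_ab th.
Proof. by apply: sympemb_eq => q; exact: turning_map1. Qed.

Let H0 th : H (th, 0) =
  (mkcts psi_continuous : continuousType _ _) (total_angle R n th).
Proof. by apply: sympemb_eq => q; exact: turning_map0. Qed.

Lemma Phi_rank (F : fieldType) :
  let Phi_ := singular_homology_map R F (Phi a_gt0 lt_ab) in
  [/\ has_rank (Phi_ 0%N) 1, has_rank (Phi_ 1%N) 1 &
      forall k, (2 <= k)%N -> has_rank (Phi_ k) 0].
Proof.
split.
- exact: (@rank_through_circle0 R F _ _ (Phi a_gt0 lt_ab) (total_angle R n)
    (mkcts psi_continuous) H (fun=> angle_pi 0) H_continuous H1 H0).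
- exact: (@rank_through_circle1 R F _ _ (Phi a_gt0 lt_ab) (total_angle R n)
    (mkcts psi_continuous) (sympemb_phase a b) H (torus_loop R n) H_continuous
    H1 H0 (sympemb_phase_Phi a_gt0 lt_ab) (torus_loop_cycle _ _ _)
    (total_angle_loop R n)).
- exact: (@rank_through_circle_high R F _ _ (Phi a_gt0 lt_ab) (total_angle R n)
    (mkcts psi_continuous) H H_continuous H1 H0).
Qed.

End PhiFactorization.

Theorem proposition1p4 (R : realType) (n : nat) (a b : 'I_n.+1 -> R)
    (a_gt0 : forall i, 0 < a i) (b_gt0 : forall i, 0 < b i)
    (a_nd : {homo a : i j / (i <= j)%N >-> i <= j})
    (b_nd : {homo b : i j / (i <= j)%N >-> i <= j})
    (ab : a ord_max < b ord0) :
  let Phi_ := singular_homology_map R 'F_2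
    (Phi a_gt0 (lt_pointwise a_nd b_nd ab)) in
  [/\ has_rank (Phi_ 0%N) 1,
      has_rank (Phi_ 1%N) 1 &
      forall k, (2 <= k)%N -> has_rank (Phi_ k) 0].
Proof. exact: Phi_rank. Qed.
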